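(* Let $M$ be a commutative monoid and let $\mathcal V$ be the semigroup variety generated by $M$. Then $\mathcal V$ is definable in the lattice $\mathbf{Com}$: there is a first-order formula $\Phi(x)$ with one free variable in the language $\{\vee,\wedge\}$ such that, for every commutative semigroup variety $\mathcal X$, $\Phi(\mathcal X)$ holds in $\mathbf{Com}$ if and only if $\mathcal X=\mathcal V$.
   Context: $\mathbf{Com}$ denotes the lattice of all commutative semigroup varieties, ordered by inclusion, with join $\vee$ and meet $\wedge$. A subset $A$ of a lattice $L$ (or a single element) is definable in $L$ if there is a first-order formula $\Phi(x)$ with one free variable in the language of the lattice operations $\vee,\wedge$ such that for $a\in L$, $\Phi(a)$ is true in $L$ iff $a\in A$. *)

(* Defs.v *)
From Stdlib Require Import Arith.

Record csg := CSg {
  csg_car :> Type;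
  csg_op : csg_car -> csg_car -> csg_car;
  csg_opA : forall x y z, csg_op x (csg_op y z) = csg_op (csg_op x y) z;
  csg_opC : forall x y, csg_op x y = csg_op y x
}.

Record comMonoid := CMon {
  mon_car :> Type;
  mon_op : mon_car -> mon_car -> mon_car;
  mon_one : mon_car;
  mon_opA : forall x y z, mon_op x (mon_op y z) = mon_op (mon_op x y) z;
  mon_opC : forall x y, mon_op x y = mon_op y x;
  mon_op1 : forall x, mon_op mon_one x = x
}.

Definition csg_of_monoid (M : comMonoid) : csg :=
  @CSg (mon_car M) (@mon_op M) (@mon_opA M) (@mon_opC M).

Inductive sterm : Type :=
| SVar : nat -> sterm
| SMul : sterm -> sterm -> sterm.

Fixpoint seval (S : csg) (a : nat -> S) (t : sterm) : S :=
  match t with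
  | SVar n => a n
  | SMul t1 t2 => csg_op S (seval S a t1) (seval S a t2)
  end.

Definition identity := (sterm * sterm)%type.

Definition sat_id (S : csg) (e : identity) : Prop :=
  forall a : nat -> S, seval S a (fst e) = seval S a (snd e).

Definition Mod (Sigma : identity -> Prop) : csg -> Prop :=
  fun S => forall e, Sigma e -> sat_id S e.

Definition Id (K : csg -> Prop) : identity -> Prop :=
  fun e => forall S, K S -> sat_id S e.

Definition is_variety (K : csg -> Prop) : Prop :=
  exists Sigma : identity -> Prop, forall S, K S <-> Mod Sigma S.

Definition Com : Type := { K : csg -> Prop | is_variety K }.

Lemma Mod_is_variety (Sigma : identity -> Prop) : is_variety (Mod Sigma).
Proof. exists Sigma; intros S; split; auto. Qed.

Lemma meet_is_variety (X Y : csg -> Prop) :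
  is_variety X -> is_variety Y -> is_variety (fun S => X S /\ Y S).
Proof.
  intros [SX HX] [SY HY].
  exists (fun e => SX e \/ SY e); intros S; split.
  - intros [HXS HYS] e [He|He].
    + apply HX; assumption.
    + apply HY; assumption.
  - intros H; split.
    + apply HX; intros e He; apply H; left; exact He.
    + apply HY; intros e He; apply H; right; exact He.
Qed.

Definition com_join (X Y : Com) : Com :=
  exist _ (Mod (fun e => Id (proj1_sig X) e /\ Id (proj1_sig Y) e))
          (Mod_is_variety _).

Definition com_meet (X Y : Com) : Com :=
  exist _ (fun S => proj1_sig X S /\ proj1_sig Y S)
          (meet_is_variety _ _ (proj2_sig X) (proj2_sig Y)).

Definition var_gen (S : csg) : Com :=
  exist _ (Mod (sat_id S)) (Mod_is_variety _).

Inductive lterm : Type :=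
| LVar : nat -> lterm
| LJoin : lterm -> lterm -> lterm
| LMeet : lterm -> lterm -> lterm.

Inductive lform : Type :=
| LEq : lterm -> lterm -> lform
| LTrue : lform
| LFalse : lform
| LNot : lform -> lform
| LAnd : lform -> lform -> lform
| LOr : lform -> lform -> lform
| LImp : lform -> lform -> lform
| LForall : nat -> lform -> lform
| LExists : nat -> lform -> lform.

Fixpoint occurs_t (n : nat) (t : lterm) : Prop :=
  match t with
  | LVar m => m = n
  | LJoin t1 t2 | LMeet t1 t2 => occurs_t n t1 \/ occurs_t n t2
  end.

Fixpoint occurs_free (n : nat) (f : lform) : Prop :=
  match f with
  | LEq t1 t2 => occurs_t n t1 \/ occurs_t n t2
  | LTrue | LFalse => False
  | LNot g => occurs_free n g
  | LAnd g h | LOr g h | LImp g h => occurs_free n g \/ occurs_free n h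
  | LForall m g | LExists m g => n <> m /\ occurs_free n g
  end.

Section LatticeSemantics.
Variables (L : Type) (join meet : L -> L -> L).

Fixpoint leval (rho : nat -> L) (t : lterm) : L :=
  match t with
  | LVar n => rho n
  | LJoin t1 t2 => join (leval rho t1) (leval rho t2)
  | LMeet t1 t2 => meet (leval rho t1) (leval rho t2)
  end.

Definition upd (rho : nat -> L) (n : nat) (a : L) : nat -> L :=
  fun m => if Nat.eqb m n then a else rho m.

Fixpoint lsat (rho : nat -> L) (f : lform) : Prop :=
  match f with
  | LEq t1 t2 => leval rho t1 = leval rho t2
  | LTrue => True
  | LFalse => False
  | LNot g => ~ lsat rho g
  | LAnd g h => lsat rho g /\ lsat rho h
  | LOr g h => lsat rho g \/ lsat rho h
  | LImp g h => lsat rho g -> lsat rho h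
  | LForall m g => forall a : L, lsat (upd rho m a) g
  | LExists m g => exists a : L, lsat (upd rho m a) g
  end.

Definition definable_elt (a : L) : Prop :=
  exists Phi : lform,
    (forall n, occurs_free n Phi -> n = 0) /\
    (forall x : L, lsat (fun _ => x) Phi <-> x = a).

End LatticeSemantics.

(* Main.v *)
From Stdlib Require Import Arith Lia Classical ClassicalEpsilon.
From Stdlib Require Import FunctionalExtensionality PropExtensionality ProofIrrelevance.
Require Import Defs.

(** A variety is determined by its identities, and the variety of a commutative
    monoid is either the top of the lattice or
    [V m n] = Mod{x^m = x^(m+n)} = [V m 1] \/ [V 0 n], where [V 0 n] is the variety
    of abelian groups of exponent dividing [n].

    The variety [K2] = Mod{x^2 = 0} is the only nontrivial variety whose
    subvarieties form a chain and which covers no variety. Its proper subvarieties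
    [L k] = Mod{x^2 = 0, x1...x(k+1) = 0} are a copy of the natural numbers. From
    [L 1], the zero-multiplication semigroups, one defines semilattices, groups,
    aperiodic and nil varieties; [Z k] = Mod{x1...xk = 0} is the largest nil
    variety not above [L k].

    Numbers are tied to exponents by the following fact. Let X be an aperiodic
    variety without x^k = x^(k+1). An identity u = v of X with |u| <= k has
    |u| = |v| and the same variables on both sides, so an exponent changes by at
    most k - 2 from u to v. Hence [Z (k+1)] lies below X \/ [V 0 n] as soon as
    n > k - 2, which defines [V k 1] (some such n exists iff X is not below
    [V k 1]). Conversely, for d + 2 <= k the variety of the monogenic nil semigroup
    with x^(k+1) = 0 satisfies x^(d+1) y^(k-d-1) = x y^(k-1), an identity of
    [V 0 d] too; so d is read off from the least k for which some X fails. *)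

(** * Terms and commutative monoids *)

Fixpoint occ (t : sterm) (x : nat) : nat :=
  match t with
  | SVar n => if n =? x then 1 else 0
  | SMul t1 t2 => occ t1 x + occ t2 x
  end.

Fixpoint len (t : sterm) : nat :=
  match t with SVar _ => 1 | SMul t1 t2 => len t1 + len t2 end.

Fixpoint subst (f : nat -> sterm) (t : sterm) : sterm :=
  match t with SVar n => f n | SMul t1 t2 => SMul (subst f t1) (subst f t2) end.

(* [tpow t k] is t^k for [1 <= k]; since there is no empty term, [tpow t 0 = t]. *)
Fixpoint tpow (t : sterm) (k : nat) : sterm :=
  match k with
  | 0 => t
  | S k' => match k' with 0 => t | S _ => SMul t (tpow t k') end
  end.

Lemma occ_tpow t k x : 1 <= k -> occ (tpow t k) x = k * occ t x.
Proof.
  induction k as [|[|k] IH]; intros Hk; [lia|simpl; lia|].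
  change (occ t x + occ (tpow t (S k)) x = S (S k) * occ t x).
  rewrite IH; lia.
Qed.

Lemma len_tpow t k : 1 <= k -> len (tpow t k) = k * len t.
Proof.
  induction k as [|[|k] IH]; intros Hk; [lia|simpl; lia|].
  change (len t + len (tpow t (S k)) = S (S k) * len t).
  rewrite IH; lia.
Qed.

Lemma subst_tpow f t k : subst f (tpow t k) = tpow (subst f t) k.
Proof.
  induction k as [|[|k] IH]; try reflexivity.
  change (SMul (subst f t) (subst f (tpow t (S k))) = SMul (subst f t) (tpow (subst f t) (S k))).
  now rewrite IH.
Qed.

Lemma len_pos t : 1 <= len t.
Proof. induction t; simpl; lia. Qed.

Lemma occ_le_len t x : occ t x <= len t.
Proof. induction t as [n|]; simpl; [destruct (n =? x)|]; lia. Qed.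

Lemma occ_add_le_len t x y : x <> y -> occ t x + occ t y <= len t.
Proof.
  intros H; induction t as [n|]; simpl; [|lia].
  destruct (Nat.eqb_spec n x), (Nat.eqb_spec n y); lia.
Qed.

Lemma occ_pos_ex t : exists x, 1 <= occ t x.
Proof.
  induction t as [n|t1 [x Hx]]; [exists n|exists x]; simpl; [rewrite Nat.eqb_refl|]; lia.
Qed.

Lemma occ_other t x : occ t x < len t -> exists y, y <> x /\ 1 <= occ t y.
Proof.
  induction t as [n|t1 IH1 t2 IH2]; simpl; intros H.
  - destruct (Nat.eqb_spec n x); [lia|]. exists n; rewrite Nat.eqb_refl; split; [assumption|lia].
  - destruct (Nat.lt_ge_cases (occ t1 x) (len t1)) as [H1|H1].
    + destruct (IH1 H1) as (y & ? & ?); exists y; split; [assumption|lia].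
    + destruct IH2 as (y & ? & ?); [lia|]. exists y; split; [assumption|lia].
Qed.

Lemma len_subst_ge f t : len t <= len (subst f t).
Proof. induction t; simpl; [apply len_pos|lia]. Qed.

Lemma occ_subst_ge f t x z : occ t x * occ (f x) z <= occ (subst f t) z.
Proof.
  induction t as [n|]; simpl; [destruct (Nat.eqb_spec n x); subst; lia|nia].
Qed.

Lemma occ_remove t x : 1 <= occ t x ->
  t = SVar x \/ exists s, forall y, occ t y = occ (SMul (SVar x) s) y.
Proof.
  induction t as [n|t1 IH1 t2 IH2]; simpl; intros H.
  - left; destruct (Nat.eqb_spec n x); [now subst|lia].
  - right; destruct (Nat.eq_dec (occ t1 x) 0) as [E|E].
    + destruct IH2 as [->|[s Hs]]; [lia|exists t1; intros; simpl; lia|].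
      exists (SMul t1 s); intros y; specialize (Hs y); simpl in *; lia.
    + destruct IH1 as [->|[s Hs]]; [lia|exists t2; intros; simpl; lia|].
      exists (SMul s t2); intros y; specialize (Hs y); simpl in *; lia.
Qed.

(** Divisibility in the free commutative semigroup. Equality is a separate case because there is no
    empty cofactor; [v] is divided by [u1] and the cofactor by [u2]. *)
Lemma occ_divide u v : (forall x, occ u x <= occ v x) ->
  (forall x, occ u x = occ v x) \/ exists t, forall x, occ v x = occ (SMul u t) x.
Proof.
  revert v; induction u as [n|u1 IH1 u2 IH2]; intros v H.
  - destruct (occ_remove v n) as [->|Hs]; auto.
    specialize (H n); simpl in H; rewrite Nat.eqb_refl in H; exact H.
  - simpl in H. destruct (IH1 v) as [E|[t Ht]].
    + intros x; specialize (H x); lia.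
    + destruct (occ_pos_ex u2) as [x Hx]; specialize (H x); specialize (E x); lia.
    + simpl in Ht. destruct (IH2 t) as [E|[s Hs]].
      * intros x; specialize (H x); specialize (Ht x); lia.
      * left; intros x; simpl; rewrite Ht, E; reflexivity.
      * right; exists s; intros x; specialize (Hs x); simpl in *; rewrite Ht, Hs; lia.
Qed.

Lemma occ_split w j : 1 <= j < len w ->
  exists w1 w2, len w1 = j /\ len w1 + len w2 = len w /\ forall x, occ w x = occ (SMul w1 w2) x.
Proof.
  revert j; induction w as [n|a IHa b IHb]; simpl; intros j Hj; [lia|].
  pose proof (len_pos a); pose proof (len_pos b).
  destruct (lt_eq_lt_dec j (len a)) as [[L|E]|G].
  - destruct (IHa j) as (w1 & w2 & ? & ? & O); [lia|].
    exists w1, (SMul w2 b); simpl in *; repeat split; try lia; intros x; rewrite O; lia.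
  - exists a, b; repeat split; lia.
  - destruct (IHb (j - len a)) as (w1 & w2 & ? & ? & O); [lia|].
    exists (SMul a w1), w2; simpl in *; repeat split; try lia; intros x; rewrite O; lia.
Qed.

Definition linear (t : sterm) : Prop := forall x, occ t x <= 1.

Lemma subst_ext f g t : (forall x, 1 <= occ t x -> f x = g x) -> subst f t = subst g t.
Proof.
  induction t as [n|t1 IH1 t2 IH2]; simpl; intros H.
  - apply H; rewrite Nat.eqb_refl; lia.
  - rewrite IH1, IH2; try reflexivity; intros x Hx; apply H; lia.
Qed.

(** Cut [w] into as many pieces as [u] has letters; each variable of [u] occurs once, so the pieces
    can be assigned independently. *)
Lemma linear_subst u w : linear u -> len u <= len w ->
  exists f, forall x, occ (subst f u) x = occ w x.
Proof.
  revert w; induction u as [n|u1 IH1 u2 IH2]; intros w L H.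
  - exists (fun _ => w); reflexivity.
  - simpl in H. pose proof (len_pos u1); pose proof (len_pos u2).
    destruct (occ_split w (len u1)) as (w1 & w2 & E1 & E2 & O); [lia|].
    destruct (IH1 w1) as [f1 F1]; [intros x; specialize (L x); simpl in L; lia|lia|].
    destruct (IH2 w2) as [f2 F2]; [intros x; specialize (L x); simpl in L; lia|lia|].
    (* Linearity keeps the variables of [u1] and [u2] disjoint, so [f1] and [f2] can be glued. *)
    exists (fun x => if occ u1 x =? 0 then f2 x else f1 x); intros x; simpl.
    rewrite O; simpl; rewrite <- F1, <- F2; f_equal; f_equal; apply subst_ext;
      intros y Hy; specialize (L y); simpl in L; destruct (Nat.eqb_spec (occ u1 y) 0); trivial; lia.
Qed.

(** * Evaluation in commutative monoids *)

Fixpoint mpow (M : comMonoid) (a : M) (k : nat) : M :=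
  match k with 0 => mon_one M | S k' => mon_op M a (mpow M a k') end.

Fixpoint mprod (M : comMonoid) (N : nat) (f : nat -> M) : M :=
  match N with 0 => mon_one M | S N' => mon_op M (mprod M N' f) (f N') end.

Lemma mpow_add M a j k : mpow M a (j + k) = mon_op M (mpow M a j) (mpow M a k).
Proof.
  induction j as [|j IH]; simpl; [now rewrite mon_op1|].
  now rewrite IH, mon_opA.
Qed.

Lemma mprod_mul M N f g :
  mprod M N (fun x => mon_op M (f x) (g x)) = mon_op M (mprod M N f) (mprod M N g).
Proof.
  induction N as [|N IH]; simpl; [now rewrite mon_op1|].
  rewrite IH, <- !mon_opA; f_equal.
  rewrite (mon_opC M (mprod M N g)), <- !mon_opA; f_equal; apply mon_opC.
Qed.

Lemma mprod_ext M N f g : (forall x, f x = g x) -> mprod M N f = mprod M N g.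
Proof. intros H; induction N; simpl; congruence. Qed.

Lemma mprod_one M N f : (forall x, x < N -> f x = mon_one M) -> mprod M N f = mon_one M.
Proof.
  induction N as [|N IH]; simpl; intros H; [reflexivity|].
  rewrite IH, H by auto; apply mon_op1.
Qed.

Lemma mprod_single M N f n : n < N -> (forall x, x <> n -> f x = mon_one M) ->
  mprod M N f = f n.
Proof.
  induction N as [|N IH]; simpl; intros Hn H; [lia|].
  destruct (Nat.eq_dec n N) as [->|Hne].
  - rewrite mprod_one by (intros; apply H; lia). apply mon_op1.
  - rewrite IH, (H N) by (trivial; lia). now rewrite mon_opC, mon_op1.
Qed.

Lemma occ_bound t : exists N, forall x, N <= x -> occ t x = 0.
Proof.
  induction t as [n|t1 [N1 H1] t2 [N2 H2]].
  - exists (S n); intros x Hx; simpl; destruct (Nat.eqb_spec n x); lia.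
  - exists (max N1 N2); intros x Hx; simpl; rewrite H1, H2; lia.
Qed.

Lemma seval_mprod M a t N : (forall x, N <= x -> occ t x = 0) ->
  seval (csg_of_monoid M) a t = mprod M N (fun x => mpow M (a x) (occ t x)).
Proof.
  intros H; induction t as [n|t1 IH1 t2 IH2]; simpl.
  - assert (n < N).
    { apply Nat.nle_gt; intros C; specialize (H n C); simpl in H; rewrite Nat.eqb_refl in H; lia. }
    rewrite (mprod_single M N _ n); trivial.
    + rewrite Nat.eqb_refl; simpl; now rewrite mon_opC, mon_op1.
    + intros x Hx; destruct (Nat.eqb_spec n x); [congruence|reflexivity].
  - simpl in H; rewrite IH1, IH2 by (intros x Hx; specialize (H x Hx); lia).
    rewrite <- mprod_mul; apply mprod_ext; intros x; symmetry; apply mpow_add.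
Qed.

Lemma seval_mpow_ext M a u v :
  (forall x, mpow M (a x) (occ u x) = mpow M (a x) (occ v x)) ->
  seval (csg_of_monoid M) a u = seval (csg_of_monoid M) a v.
Proof.
  intros H; destruct (occ_bound u) as [N1 H1], (occ_bound v) as [N2 H2].
  rewrite !(seval_mprod M a _ (max N1 N2)) by (intros; (apply H1 || apply H2); lia).
  apply mprod_ext, H.
Qed.

Definition opt_op (S : csg) (x y : option S) : option S :=
  match x, y with
  | Some a, Some b => Some (csg_op S a b)
  | None, y => y
  | x, None => x
  end.

(** With an identity adjoined, the exponent 0 has a value, so two words can be compared one variable
    at a time even if a variable is missing from one of them. *)
Definition adjoin_one (S : csg) : comMonoid.
Proof.
  refine (CMon (option S) (opt_op S) None _ _ _).
  - intros [x|] [y|] [z|]; simpl; trivial; now rewrite csg_opA.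
  - intros [x|] [y|]; simpl; trivial; now rewrite csg_opC.
  - intros [x|]; reflexivity.
Defined.

Lemma seval_adjoin_one (S : csg) (a : nat -> S) t :
  seval (csg_of_monoid (adjoin_one S)) (fun x => Some (a x)) t = Some (seval S a t).
Proof. induction t as [n|t1 IH1 t2 IH2]; simpl; [reflexivity|now rewrite IH1, IH2]. Qed.

Lemma seval_adjoin_ext (S : csg) (a : nat -> S) u v :
  (forall x, mpow (adjoin_one S) (Some (a x)) (occ u x) = mpow (adjoin_one S) (Some (a x)) (occ v x)) ->
  seval S a u = seval S a v.
Proof.
  intros H; apply (seval_mpow_ext (adjoin_one S)) in H.
  rewrite !seval_adjoin_one in H; congruence.
Qed.

Lemma occ_eval (S : csg) (a : nat -> S) u v :
  (forall x, occ u x = occ v x) -> seval S a u = seval S a v.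
Proof. intros H; apply seval_adjoin_ext; intros x; now rewrite H. Qed.

Lemma seval_subst (S : csg) (a : nat -> S) f t :
  seval S a (subst f t) = seval S (fun x => seval S a (f x)) t.
Proof. induction t as [n|t1 IH1 t2 IH2]; simpl; [reflexivity|now rewrite IH1, IH2]. Qed.

(** Occurrence counts and lengths are evaluations in (N, +), so the results on evaluation apply to
    them too. *)
Definition nat_mon : comMonoid :=
  CMon nat Nat.add 0 Nat.add_assoc Nat.add_comm Nat.add_0_l.

Definition nat_csg : csg := csg_of_monoid nat_mon.

Lemma mpow_nat a k : mpow nat_mon a k = k * a.
Proof. induction k as [|k IH]; simpl; [reflexivity|now rewrite IH]. Qed.

Lemma occ_subst f t x : occ (subst f t) x = seval nat_csg (fun y => occ (f y) x) t.
Proof. induction t as [n|t1 IH1 t2 IH2]; simpl; [reflexivity|now rewrite IH1, IH2]. Qed.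

Lemma occ_subst_eq f u v : (forall x, occ u x = occ v x) ->
  forall x, occ (subst f u) x = occ (subst f v) x.
Proof. intros H x; rewrite !occ_subst; exact (occ_eval nat_csg _ u v H). Qed.

Lemma len_occ u v : (forall x, occ u x = occ v x) -> len u = len v.
Proof.
  assert (E : forall t, len t = seval nat_csg (fun _ => 1) t).
  { intros t; induction t as [n|t1 IH1 t2 IH2]; simpl; congruence. }
  intros H; rewrite !E; exact (occ_eval nat_csg _ u v H).
Qed.

(** * Varieties and their identities *)

Definition holds (X : Com) (u v : sterm) : Prop := Id (proj1_sig X) (u, v).

Definition leC (X Y : Com) : Prop := com_join X Y = Y.

Lemma holds_sat X S u v : holds X u v -> proj1_sig X S -> forall a, seval S a u = seval S a v.
Proof. intros H HS; exact (H S HS). Qed.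

Lemma variety_iff (X : Com) S : proj1_sig X S <-> Mod (Id (proj1_sig X)) S.
Proof.
  split.
  - intros H e He; exact (He S H).
  - destruct X as [K [Sigma HK]]; simpl; intros H.
    apply HK; intros e He; apply H; intros S' HS'; apply HK in HS'; exact (HS' e He).
Qed.

(** A variety is the class of models of its own identities; extensionality and proof irrelevance
    turn equality of classes into equality in [Com]. *)
Lemma holds_ext X Y : (forall u v, holds X u v <-> holds Y u v) -> X = Y.
Proof.
  intros H.
  assert (E : forall S, proj1_sig X S <-> proj1_sig Y S).
  { intros S; rewrite !variety_iff; split; intros HS [u v] He; apply HS, H, He. }
  destruct X as [K HK], Y as [K' HK']; simpl in E.
  apply subset_eq_compat; extensionality S; apply propositional_extensionality, E.
Qed.

Lemma holds_join X Y u v : holds (com_join X Y) u v <-> holds X u v /\ holds Y u v.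
Proof.
  split.
  - intros H; split; intros S HS; apply H; intros e [H1 H2]; [exact (H1 S HS)|exact (H2 S HS)].
  - intros H S HS; apply HS; exact H.
Qed.

Lemma leC_th X Y : leC X Y <-> forall u v, holds Y u v -> holds X u v.
Proof.
  unfold leC; split.
  - intros E u v H; rewrite <- E in H; apply holds_join in H; tauto.
  - intros H; apply holds_ext; intros u v; rewrite holds_join; split; [tauto|auto].
Qed.

Lemma leC_refl X : leC X X.
Proof. apply leC_th; auto. Qed.

Lemma leC_trans Y X Z : leC X Y -> leC Y Z -> leC X Z.
Proof. rewrite !leC_th; auto. Qed.

Lemma leC_antisym X Y : leC X Y -> leC Y X -> X = Y.
Proof. rewrite !leC_th; intros; apply holds_ext; split; auto. Qed.

Lemma leC_join_l X Y : leC X (com_join X Y).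
Proof. apply leC_th; intros u v H; apply holds_join in H; tauto. Qed.

Lemma leC_join_r X Y : leC Y (com_join X Y).
Proof. apply leC_th; intros u v H; apply holds_join in H; tauto. Qed.

Lemma not_leC X Y : ~ leC X Y -> exists u v, holds Y u v /\ ~ holds X u v.
Proof.
  intros H; apply NNPP; intros C; apply H, leC_th; intros u v Hu.
  apply NNPP; intros C'; apply C; eauto.
Qed.

(** * Fully invariant congruences and Birkhoff completeness *)

Record is_theory (T : sterm -> sterm -> Prop) : Prop := {
  ty_occ : forall u v, (forall x, occ u x = occ v x) -> T u v;
  ty_sym : forall u v, T u v -> T v u;
  ty_trans : forall u v w, T u v -> T v w -> T u w;
  ty_mul : forall u v u' v', T u v -> T u' v' -> T (SMul u u') (SMul v v');
  ty_subst : forall f u v, T u v -> T (subst f u) (subst f v)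
}.

Lemma holds_theory X : is_theory (holds X).
Proof.
  split.
  - intros u v H S HS a; now apply occ_eval.
  - intros u v H S HS a; symmetry; apply (H S HS).
  - intros u v w H1 H2 S HS a; transitivity (seval S a v); [apply (H1 S HS)|apply (H2 S HS)].
  - intros u v u' v' H1 H2 S HS a; simpl; f_equal; [apply (H1 S HS)|apply (H2 S HS)].
  - intros f u v H S HS a; simpl; rewrite !seval_subst; apply (H S HS).
Qed.

Definition holds_occ X := ty_occ _ (holds_theory X).
Definition holds_sym X := ty_sym _ (holds_theory X).
Definition holds_trans X := ty_trans _ (holds_theory X).
Definition holds_mul X := ty_mul _ (holds_theory X).
Definition holds_subst X := ty_subst _ (holds_theory X).

Lemma holds_refl X u : holds X u u.
Proof. now apply holds_occ. Qed.

Section Completeness.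
Variable T : sterm -> sterm -> Prop.
Hypothesis HT : is_theory T.

(** A chosen representative stands for the class of [t]; by extensionality the choice depends on the
    class alone. *)
Definition canon (t : sterm) : sterm := epsilon (inhabits (SVar 0)) (T t).

Lemma canon_spec t : T t (canon t).
Proof. unfold canon; apply epsilon_spec; exists t; now apply ty_occ. Qed.

Lemma canon_eq u v : T u v -> canon u = canon v.
Proof.
  intros H; unfold canon; f_equal; extensionality w; apply propositional_extensionality.
  split; intros; [apply ty_trans with u|apply ty_trans with v]; trivial; now apply ty_sym.
Qed.

Lemma canon_idem t : canon (canon t) = canon t.
Proof. apply canon_eq, ty_sym, canon_spec; exact HT. Qed.

(* The free object of the variety of [T], carried by canonical representatives of the [T]-classes. *)
Definition quot_op (x y : {t | canon t = t}) : {t | canon t = t} :=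
  exist _ (canon (SMul (proj1_sig x) (proj1_sig y))) (canon_idem _).

Definition quot : csg.
Proof.
  refine (CSg {t | canon t = t} quot_op _ _).
  - intros x y z; apply subset_eq_compat, canon_eq; simpl.
    apply (ty_trans _ HT) with (SMul (proj1_sig x) (SMul (proj1_sig y) (proj1_sig z))).
    { apply (ty_mul _ HT); [now apply (ty_occ _ HT)|apply (ty_sym _ HT), canon_spec]. }
    apply (ty_trans _ HT) with (SMul (SMul (proj1_sig x) (proj1_sig y)) (proj1_sig z)).
    { apply (ty_occ _ HT); intros; simpl; lia. }
    apply (ty_mul _ HT); [apply canon_spec|now apply (ty_occ _ HT)].
  - intros x y; apply subset_eq_compat, canon_eq, (ty_occ _ HT); intros; simpl; lia.
Defined.

Lemma seval_quot (a : nat -> quot) t :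
  T (subst (fun x => proj1_sig (a x)) t) (proj1_sig (seval quot a t)).
Proof.
  induction t as [n|t1 IH1 t2 IH2]; simpl; [now apply (ty_occ _ HT)|].
  eapply (ty_trans _ HT); [apply (ty_mul _ HT); eassumption|apply canon_spec].
Qed.

Lemma quot_eq (x y : quot) : T (proj1_sig x) (proj1_sig y) -> x = y.
Proof.
  destruct x as [x Hx], y as [y Hy]; simpl; intros H.
  apply subset_eq_compat; rewrite <- Hx, <- Hy; now apply canon_eq.
Qed.

Definition com_of : Com :=
  exist _ (Mod (fun e => T (fst e) (snd e))) (Mod_is_variety _).

(** Birkhoff completeness: [quot] lies in the variety because [T] is closed under substitution, and
    evaluating at the classes of the variables gives back [T]. *)
Lemma holds_com_of u v : holds com_of u v <-> T u v.
Proof.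
  split; [|intros H S HS; exact (HS (u, v) H)].
  intros H.
  assert (Q : proj1_sig com_of quot).
  { intros [s t] Hst a; simpl in *; apply quot_eq.
    eapply (ty_trans _ HT); [apply (ty_sym _ HT); apply seval_quot|].
    eapply (ty_trans _ HT); [|apply seval_quot]. now apply ty_subst. }
  pose (a := fun n => exist (fun t => canon t = t) (canon (SVar n)) (canon_idem _) : quot).
  assert (E : forall t, T t (proj1_sig (seval quot a t))).
  { intros t; eapply (ty_trans _ HT); [|apply seval_quot].
    induction t as [n|t1 IH1 t2 IH2]; simpl; [apply canon_spec|now apply ty_mul]. }
  apply (holds_sat _ _ _ _ H) with (a := a) in Q.
  eapply (ty_trans _ HT); [apply E|]. rewrite Q. apply ty_sym; trivial.
Qed.
End Completeness.

Lemma holds_var_gen S u v : holds (var_gen S) u v <-> sat_id S (u, v).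
Proof.
  split; intros H.
  - apply (H S); intros e He; exact He.
  - intros S' HS'; exact (HS' _ H).
Qed.

(** * Congruences of (N, +) with given index and period *)

Definition cg (m n a b : nat) : Prop := a = b \/ m <= a /\ m <= b /\ a mod n = b mod n.

Lemma cg_sym m n a b : cg m n a b -> cg m n b a.
Proof. unfold cg; intuition. Qed.

Lemma cg_trans m n a b c : cg m n a b -> cg m n b c -> cg m n a c.
Proof. unfold cg; intros [->|(?&?&?)] [->|(?&?&?)]; auto; right; repeat split; trivial; congruence. Qed.

Lemma cg_add m n a b c d : cg m n a b -> cg m n c d -> cg m n (a + c) (b + d).
Proof.
  unfold cg; intros [->|(?&?&E)] [->|(?&?&F)]; auto; right; repeat split; try lia;
    rewrite Nat.Div0.add_mod, ?E, ?F, <- Nat.Div0.add_mod; reflexivity.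
Qed.

Lemma cg_mul m n a b c : cg m n a b -> cg m n (a * c) (b * c).
Proof.
  intros H; induction c as [|c IH]; [left; lia|].
  replace (a * S c) with (a + a * c) by lia; replace (b * S c) with (b + b * c) by lia.
  now apply cg_add.
Qed.

Lemma cg_mprod m n N (f g : nat -> nat) : (forall x, cg m n (f x) (g x)) ->
  cg m n (mprod nat_mon N f) (mprod nat_mon N g).
Proof. intros H; induction N; simpl; [now left|now apply cg_add]. Qed.

Definition cg_th (m n : nat) (u v : sterm) : Prop := forall x, cg m n (occ u x) (occ v x).

(** For substitution: an exponent in [subst f u] is a sum of the numbers [occ u y] with weights
    depending on [f] alone, and [cg] respects such sums. *)
Lemma cg_theory m n : is_theory (cg_th m n).
Proof.
  split.
  - intros u v H x; left; apply H.
  - intros u v H x; apply cg_sym, H.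
  - intros u v w H1 H2 x; eapply cg_trans; [apply H1|apply H2].
  - intros u v u' v' H1 H2 x; apply cg_add; [apply H1|apply H2].
  - intros f u v H x; rewrite !occ_subst.
    destruct (occ_bound u) as [N1 H1], (occ_bound v) as [N2 H2]; unfold nat_csg.
    rewrite !(seval_mprod nat_mon _ _ (max N1 N2)) by (intros; (apply H1 || apply H2); lia).
    apply cg_mprod; intros y; rewrite !mpow_nat; apply cg_mul, H.
Qed.

(* The variety defined by x^m = x^(m+n), read as y = y x^n when [m = 0]. *)
Definition V (m n : nat) : Com := com_of (cg_th m n).

Lemma holds_V m n u v : holds (V m n) u v <-> cg_th m n u v.
Proof. apply holds_com_of, cg_theory. Qed.

(** * Fully invariant ideals and their Rees congruences *)

Record is_ideal (I : sterm -> Prop) : Prop := {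
  id_occ : forall u v, (forall x, occ u x = occ v x) -> I u -> I v;
  id_mul : forall u v, I u -> I (SMul u v);
  id_subst : forall f u, I u -> I (subst f u)
}.

Definition rees_th (I : sterm -> Prop) (u v : sterm) : Prop :=
  (forall x, occ u x = occ v x) \/ I u /\ I v.

Lemma rees_theory I : is_ideal I -> is_theory (rees_th I).
Proof.
  intros HI.
  assert (Hr : forall u v, I v -> I (SMul u v)).
  { intros u v H; apply (id_occ _ HI (SMul v u)); [intros; simpl; lia|now apply id_mul]. }
  split.
  - now left.
  - intros u v [H|[H1 H2]]; [left|right]; auto.
  - intros u v w [H|[H1 H2]] [H'|[H1' H2']].
    + left; intros; now rewrite H.
    + right; split; trivial; apply (id_occ _ HI v); auto.
    + right; split; trivial; apply (id_occ _ HI v); auto.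
    + right; auto.
  - intros u v u' v' [H|[H1 H2]] [H'|[H1' H2']].
    + left; intros; simpl; auto.
    + right; split; auto.
    + right; split; apply id_mul; auto.
    + right; split; auto.
  - intros f u v [H|[H1 H2]]; [left; now apply occ_subst_eq|right; split; now apply id_subst].
Qed.

Definition nonlinear (t : sterm) : Prop := exists x, 2 <= occ t x.

Lemma not_nonlinear t : ~ nonlinear t <-> linear t.
Proof.
  split.
  - intros H x; apply Nat.nlt_ge; intros C; apply H; exists x; lia.
  - intros H [x Hx]; specialize (H x); lia.
Qed.

Lemma nonlinear_ideal : is_ideal nonlinear.
Proof.
  split.
  - intros u v H [x Hx]; exists x; now rewrite <- H.
  - intros u v [x Hx]; exists x; simpl; lia.
  - intros f u [x Hx]; destruct (occ_pos_ex (f x)) as [z Hz]; exists z.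
    pose proof (occ_subst_ge f u x z); nia.
Qed.

Lemma long_ideal k : is_ideal (fun t => k <= len t).
Proof.
  split.
  - intros u v H; rewrite (len_occ u v); auto.
  - intros u v H; simpl; lia.
  - intros f u H; pose proof (len_subst_ge f u); lia.
Qed.

Lemma union_ideal I J : is_ideal I -> is_ideal J -> is_ideal (fun t => I t \/ J t).
Proof.
  intros HI HJ; split.
  - intros u v H [H'|H']; [left; eapply (id_occ _ HI)|right; eapply (id_occ _ HJ)]; eauto.
  - intros u v [H|H]; [left|right]; now apply id_mul.
  - intros f u [H|H]; [left|right]; now apply id_subst.
Qed.

Definition K2 : Com := com_of (rees_th nonlinear).
Definition Z (k : nat) : Com := com_of (rees_th (fun t => k <= len t)).
Definition L (k : nat) : Com := com_of (rees_th (fun t => nonlinear t \/ S k <= len t)).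

Lemma holds_K2 u v : holds K2 u v <-> rees_th nonlinear u v.
Proof. apply holds_com_of, rees_theory, nonlinear_ideal. Qed.

Lemma holds_Z k u v : holds (Z k) u v <-> rees_th (fun t => k <= len t) u v.
Proof. apply holds_com_of, rees_theory, long_ideal. Qed.

Lemma holds_L k u v : holds (L k) u v <-> rees_th (fun t => nonlinear t \/ S k <= len t) u v.
Proof. apply holds_com_of, rees_theory, union_ideal; [apply nonlinear_ideal|apply long_ideal]. Qed.

(** * Index and period *)

Lemma least_nat (P : nat -> Prop) : (exists n, P n) -> exists n, P n /\ forall m, P m -> n <= m.
Proof.
  intros [n Hn]; apply NNPP; intros C.
  revert Hn; induction n as [n IH] using lt_wf_ind; intros Hn.
  apply C; exists n; split; trivial; intros m Hm.
  apply Nat.nlt_ge; intros Hlt; exact (IH m Hlt Hm).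
Qed.

Lemma mod_eq_add n i j : i <= j -> i mod n = j mod n -> exists q, j = i + q * n.
Proof.
  intros Hij E; exists (j / n - i / n).
  pose proof (Nat.div_mod_eq i n); pose proof (Nat.div_mod_eq j n).
  pose proof (Nat.Div0.div_le_mono i j n Hij). nia.
Qed.

Lemma mod_add_eq n i q : (i + q * n) mod n = i mod n.
Proof. apply Nat.Div0.mod_add. Qed.

Lemma cg_add_mul m n a q : m <= a -> cg m n a (a + q * n).
Proof. intros H; right; repeat split; [lia|lia|symmetry; apply mod_add_eq]. Qed.

(** The index [m] is the least number related to a larger one, and [n] is the least period found at
    [m]. *)
Lemma congruence_classify (E : nat -> nat -> Prop) :
  (forall a, E a a) -> (forall a b, E a b -> E b a) ->
  (forall a b c, E a b -> E b c -> E a c) -> (forall a b c, E a b -> E (a + c) (b + c)) ->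
  (exists a b, a <> b /\ E a b) ->
  exists m n, 1 <= n /\ forall a b, E a b <-> cg m n a b.
Proof.
  intros R Sy T A [a0 [b0 [Hab0 E0]]].
  destruct (least_nat (fun a => exists n, 1 <= n /\ E a (a + n))) as [m [[n1 Hn1] Hm]].
  { destruct (Nat.lt_total a0 b0) as [H|[H|H]]; [|lia|].
    - exists a0, (b0 - a0); split; [lia|]. now replace (a0 + (b0 - a0)) with b0 by lia.
    - exists b0, (a0 - b0); split; [lia|]. replace (b0 + (a0 - b0)) with a0 by lia; auto. }
  destruct (least_nat (fun n => 1 <= n /\ E m (m + n))) as [n [[Hn En] Hmin]]; [eauto|].
  exists m, n; split; trivial.
  assert (P : forall q a, m <= a -> E a (a + q * n)).
  { intros q a Ha; induction q as [|q IH].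
    - now rewrite Nat.add_0_r.
    - apply T with (a + q * n); trivial.
      apply (A _ _ (a + q * n - m)) in En.
      replace (m + (a + q * n - m)) with (a + q * n) in En by lia.
      now replace (m + n + (a + q * n - m)) with (a + S q * n) in En by lia. }
  (* A period [d] at [a] is carried back to [m]: climb from [m] past [a] by a multiple of [n], add
     [d], and descend by the same multiple. *)
  assert (Q : forall a d, m <= a -> 1 <= d -> E a (a + d) -> n <= d).
  { intros a d Ha Hd Ed; apply Hmin; split; trivial.
    assert (Ht : exists t, a <= m + t * n) by (exists a; nia).
    destruct Ht as [t Ht].
    apply T with (m + t * n); [now apply P|].
    apply T with (m + t * n + d).
    - apply (A _ _ (m + t * n - a)) in Ed.
      replace (a + (m + t * n - a)) with (m + t * n) in Ed by lia.
      now replace (a + d + (m + t * n - a)) with (m + t * n + d) in Ed by lia.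
    - apply Sy. replace (m + t * n + d) with (m + d + t * n) by lia. apply P; lia. }
  assert (W : forall a b, a <= b -> E a b -> cg m n a b).
  { intros a b Hab Eab. destruct (Nat.eq_dec a b) as [->|Hne]; [now left|right].
    assert (Hma : m <= a).
    { apply Hm; exists (b - a); split; [lia|]. now replace (a + (b - a)) with b by lia. }
    split; [lia|]; split; [lia|].
    pose proof (Nat.div_mod_eq (b - a) n) as D.
    pose proof (Nat.mod_upper_bound (b - a) n) as U.
    set (q := (b - a) / n) in *; set (r := (b - a) mod n) in *.
    (* A nonzero remainder [r] would be a period shorter than [n]. *)
    destruct (Nat.eq_dec r 0) as [Hr|Hr].
    - replace b with (a + q * n) by nia. now rewrite mod_add_eq.
    - assert (n <= r); [|lia]. apply (Q a); [lia|lia|].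
      apply T with b; trivial. replace b with (a + r + q * n) by nia. apply Sy, P; lia. }
  intros a b; split.
  - intros Eab; destruct (Nat.le_ge_cases a b) as [H|H]; [auto|apply cg_sym; auto].
  - intros [->|[Ha [Hb Em]]]; [apply R|].
    destruct (Nat.le_ge_cases a b) as [H|H].
    + destruct (mod_eq_add n a b H Em) as [q ->]; now apply P.
    + destruct (mod_eq_add n b a H (eq_sym Em)) as [q ->]; now apply Sy, P.
Qed.

Definition xp (k : nat) : sterm := tpow (SVar 0) k.

Lemma occ_xp k x : 1 <= k -> occ (xp k) x = if 0 =? x then k else 0.
Proof.
  intros H; unfold xp; rewrite occ_tpow by trivial.
  unfold occ; destruct (0 =? x); lia.
Qed.

Lemma len_xp k : 1 <= k -> len (xp k) = k.
Proof. intros H; unfold xp; rewrite len_tpow by trivial; simpl; lia. Qed.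

Definition pow_id (X : Com) (a b : nat) : Prop := holds X (xp a) (xp b).

Lemma pow_id_add X a b c : 1 <= a -> 1 <= b -> pow_id X a b -> pow_id X (a + c) (b + c).
Proof.
  intros Ha Hb H; destruct c as [|c]; [now rewrite !Nat.add_0_r|].
  apply holds_trans with (SMul (xp a) (xp (S c))).
  { apply holds_occ; intros x; cbn [occ]; rewrite !occ_xp by lia; destruct (0 =? x); lia. }
  apply holds_trans with (SMul (xp b) (xp (S c))).
  { apply holds_mul; [exact H|apply holds_refl]. }
  apply holds_occ; intros x; cbn [occ]; rewrite !occ_xp by lia; destruct (0 =? x); lia.
Qed.

(** This substitution collapses an identity to one variable while recording, with weights [a] and
    [b], the length of a word and its exponent at [y]. *)
Definition spread (a b y : nat) : nat -> sterm := fun z => if z =? y then xp (a + b) else xp a.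

Lemma occ_spread a b y u x : 1 <= a ->
  occ (subst (spread a b y) u) x = if 0 =? x then a * len u + b * occ u y else 0.
Proof.
  intros Ha; induction u as [n|u1 IH1 u2 IH2].
  - cbn [subst occ len]; unfold spread; destruct (n =? y); rewrite occ_xp by lia;
      destruct (0 =? x); lia.
  - cbn [subst occ len]; rewrite IH1, IH2; destruct (0 =? x); lia.
Qed.

Lemma holds_one_var X a b y u v : 1 <= a -> holds X u v ->
  pow_id X (a * len u + b * occ u y) (a * len v + b * occ v y).
Proof.
  intros Ha H; pose proof (len_pos u); pose proof (len_pos v).
  apply (holds_subst X (spread a b y)) in H.
  apply holds_trans with (subst (spread a b y) u).
  { apply holds_occ; intros x; rewrite occ_spread, occ_xp by nia; destruct (0 =? x); lia. }
  apply holds_trans with (subst (spread a b y) v); trivial.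
  apply holds_occ; intros x; rewrite occ_spread, occ_xp by nia; destruct (0 =? x); lia.
Qed.

Definition has_index_period (X : Com) (m n : nat) : Prop :=
  1 <= m /\ 1 <= n /\ forall a b, 1 <= a -> 1 <= b -> (pow_id X a b <-> cg m n a b).

Lemma index_period X a b : 1 <= a -> 1 <= b -> a <> b -> pow_id X a b -> exists m n, has_index_period X m n.
Proof.
  intros Ha Hb Hab H.
  (* Exponents start at 1, so [i] encodes x^(i+1); the index found is shifted accordingly. *)
  destruct (congruence_classify (fun i j => pow_id X (S i) (S j))) as (m & n & Hn & C).
  - intros; apply holds_refl.
  - intros i j; apply holds_sym.
  - intros i j k; apply holds_trans.
  - intros i j k Hij; apply (pow_id_add X (S i) (S j) k); trivial; lia.
  - exists (a - 1), (b - 1); split; [lia|].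
    now replace (S (a - 1)) with a by lia; replace (S (b - 1)) with b by lia.
  - exists (S m), n; split; [lia|]; split; trivial.
    intros i j Hi Hj; specialize (C (i - 1) (j - 1)).
    replace (S (i - 1)) with i in C by lia; replace (S (j - 1)) with j in C by lia.
    rewrite C; split.
    + intros D. replace i with (i - 1 + 1) by lia; replace j with (j - 1 + 1) by lia.
      destruct D as [->|(?&?&?)]; [now left|right; split; [lia|split; [lia|]]].
      rewrite Nat.Div0.add_mod, H2, <- Nat.Div0.add_mod; reflexivity.
    + intros [->|(?&?&E)]; [now left|right; split; [lia|split; [lia|]]].
      destruct (Nat.le_ge_cases i j) as [L|L].
      * destruct (mod_eq_add n i j L E) as [q ->].
        replace (i + q * n - 1) with (i - 1 + q * n) by lia; now rewrite mod_add_eq.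
      * destruct (mod_eq_add n j i L (eq_sym E)) as [q ->].
        replace (j + q * n - 1) with (j - 1 + q * n) by lia; now rewrite mod_add_eq.
Qed.

(** Sending all variables to x exposes a difference of lengths; if the lengths agree, sending [y] to
    x^2 instead exposes the difference at [y]. *)
Lemma index_period_th X u v y : holds X u v -> occ u y <> occ v y -> exists m n, has_index_period X m n.
Proof.
  intros H Hne; pose proof (len_pos u); pose proof (len_pos v).
  destruct (Nat.eq_dec (len u) (len v)) as [E|E].
  - apply (index_period X (1 * len u + 1 * occ u y) (1 * len v + 1 * occ v y)); try lia.
    apply holds_one_var; trivial; lia.
  - apply (index_period X (1 * len u + 0 * occ u y) (1 * len v + 0 * occ v y)); try lia.
    apply holds_one_var; trivial; lia.
Qed.

Lemma seval_tpow M a t k : 1 <= k ->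
  seval (csg_of_monoid M) a (tpow t k) = mpow M (seval (csg_of_monoid M) a t) k.
Proof.
  induction k as [|[|k] IH]; intros Hk; [lia|simpl; now rewrite mon_opC, mon_op1|].
  change (mon_op M (seval (csg_of_monoid M) a t) (seval (csg_of_monoid M) a (tpow t (S k)))
          = mpow M (seval (csg_of_monoid M) a t) (S (S k))).
  now rewrite IH by lia.
Qed.

(** In a member of [X] with an identity adjoined, every value satisfies x^m = x^(m+n), so each
    exponent can be changed separately within its class. *)
Lemma leC_V X m n : 1 <= m -> 1 <= n -> pow_id X m (m + n) -> leC X (V m n).
Proof.
  intros Hm Hn H; apply leC_th; intros u v Huv G HG a; simpl.
  apply holds_V in Huv; apply seval_adjoin_ext; intros x.
  set (M := adjoin_one G); set (s := Some (a x) : M).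
  assert (P : mpow M s m = mpow M s (m + n)).
  { pose proof (holds_sat _ _ _ _ H HG (fun _ => a x)) as E.
    apply (f_equal (@Some G)) in E; rewrite <- !seval_adjoin_one in E; unfold xp in E.
    rewrite !seval_tpow in E by lia. exact E. }
  assert (Q : forall q i, m <= i -> mpow M s (i + q * n) = mpow M s i).
  { intros q i Hi; induction q as [|q IH]; [now rewrite Nat.add_0_r|].
    rewrite <- IH. replace (i + S q * n) with ((m + n) + (i + q * n - m)) by lia.
    rewrite mpow_add, <- P, <- mpow_add; f_equal; lia. }
  destruct (Huv x) as [->|(Hi&Hj&E)]; [reflexivity|].
  destruct (Nat.le_ge_cases (occ u x) (occ v x)) as [L|L].
  - destruct (mod_eq_add n _ _ L E) as [q ->]; now rewrite Q.
  - destruct (mod_eq_add n _ _ L (eq_sym E)) as [q ->]; now rewrite Q.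
Qed.

Lemma pow_id_V m n a b : 1 <= a -> 1 <= b -> (pow_id (V m n) a b <-> cg m n a b).
Proof.
  intros Ha Hb; unfold pow_id; rewrite holds_V; split.
  - intros H; specialize (H 0); now rewrite !occ_xp in H.
  - intros H x; rewrite !occ_xp by trivial; destruct (0 =? x); [trivial|now left].
Qed.

Lemma V0_leC X m n : has_index_period X m n -> leC (V 0 n) X.
Proof.
  intros (Hm & Hn & C); apply leC_th; intros u v H; apply holds_V; intros y.
  (* The weight [m * n] vanishes modulo [n], so only the exponents of [y] remain to be compared. *)
  apply (holds_one_var X (m * n) 1 y) in H; [|nia].
  pose proof (len_pos u); pose proof (len_pos v).
  apply C in H; [|nia|nia].
  assert (E : (occ u y + m * len u * n) mod n = (occ v y + m * len v * n) mod n).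
  { replace (occ u y + m * len u * n) with (m * n * len u + 1 * occ u y) by lia.
    replace (occ v y + m * len v * n) with (m * n * len v + 1 * occ v y) by lia.
    destruct H as [->|(?&?&?)]; trivial. }
  rewrite !mod_add_eq in E; right; repeat split; trivial; lia.
Qed.

Lemma V_join m n : V m n = com_join (V m 1) (V 0 n).
Proof.
  apply holds_ext; intros u v; rewrite holds_join, !holds_V; unfold cg_th, cg; split.
  - intros H; split; intros x; specialize (H x); [|intuition lia].
    destruct H as [|(?&?&?)]; [now left|right; repeat split; trivial; now rewrite !Nat.mod_1_r].
  - intros [H1 H2] x; specialize (H1 x); specialize (H2 x); intuition lia.
Qed.

(** Index 0 and period 1 admit every identity, which gives the trivial variety; index 1, in [SL],
    admits those with the same variables on both sides, which gives the semilattices. *)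
Definition bot : Com := V 0 1.
Definition SL : Com := V 1 1.

Lemma bot_leC X : leC bot X.
Proof.
  apply leC_th; intros u v _; apply holds_V; intros x; right.
  rewrite !Nat.mod_1_r; repeat split; lia.
Qed.

Lemma leC_V0 m n : 1 <= m -> (leC (V 0 n) (V 0 m) <-> Nat.divide n m).
Proof.
  intros Hm; split.
  - intros H; rewrite leC_th in H.
    assert (P : pow_id (V 0 n) 1 (1 + m)).
    { apply H, pow_id_V; try lia. replace (1 + m) with (1 + 1 * m) by lia. apply cg_add_mul; lia. }
    apply pow_id_V in P; try lia. destruct P as [P|(_&_&P)]; [lia|].
    destruct (mod_eq_add n 1 (1 + m)) as [q Hq]; [lia|trivial|]. exists q; lia.
  - intros [q ->]; apply leC_th; intros u v H; rewrite holds_V in *; intros x; specialize (H x).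
    destruct H as [->|(_&_&E)]; [now left|right; split; [lia|split; [lia|]]].
    destruct (Nat.le_ge_cases (occ u x) (occ v x)) as [L|L].
    + destruct (mod_eq_add _ _ _ L E) as [k ->].
      replace (k * (q * n)) with ((k * q) * n) by lia; now rewrite mod_add_eq.
    + destruct (mod_eq_add _ _ _ L (eq_sym E)) as [k ->].
      replace (k * (q * n)) with ((k * q) * n) by lia; now rewrite mod_add_eq.
Qed.

Lemma not_SL X : ~ leC SL X -> exists u v y, holds X u v /\ 1 <= occ u y /\ occ v y = 0.
Proof.
  intros H; apply not_leC in H; destruct H as (u & v & H & N).
  apply NNPP; intros C; apply N, holds_V; intros x.
  destruct (Nat.eq_dec (occ u x) 0) as [Eu|Eu], (Nat.eq_dec (occ v x) 0) as [Ev|Ev].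
  - left; congruence.
  - exfalso; apply C; exists v, u, x; split; [now apply holds_sym|lia].
  - exfalso; apply C; exists u, v, x; split; [trivial|lia].
  - right; rewrite !Nat.mod_1_r; repeat split; lia.
Qed.

Lemma not_SL_intro X u v y : holds X u v -> 1 <= occ u y -> occ v y = 0 -> ~ leC SL X.
Proof.
  intros H Hu Hv C; rewrite leC_th in C; apply C, holds_V in H; specialize (H y).
  destruct H as [H|H]; lia.
Qed.

(** An identity failing in [Z 2] has a single variable as one side; collapsed to one variable it
    becomes x = x^(1+n). *)
Lemma not_ZM X : ~ leC (Z 2) X -> exists n, 1 <= n /\ pow_id X 1 (1 + n).
Proof.
  intros H; apply not_leC in H; destruct H as (u & v & H & N).
  assert (W : forall u v, holds X u v -> len u = 1 -> ~ (forall x, occ u x = occ v x) ->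
                exists n, 1 <= n /\ pow_id X 1 (1 + n)).
  { clear; intros u v H Hu N; pose proof (len_pos v).
    destruct (Nat.eq_dec (len v) 1) as [E|E].
    - destruct u as [i|u1 u2]; [|simpl in Hu; pose proof (len_pos u1); pose proof (len_pos u2); lia].
      destruct v as [j|v1 v2]; [|simpl in E; pose proof (len_pos v1); pose proof (len_pos v2); lia].
      (* Here the identity equates two distinct variables, and sending one of them to x^2 gives x =
         x^2. *)
      exists 1; split; trivial.
      assert (i <> j) by (intros ->; apply N; reflexivity).
      apply (holds_one_var X 1 1 j) in H; trivial; simpl in H.
      rewrite Nat.eqb_refl in H; destruct (Nat.eqb_spec i j); [lia|exact H].
    - exists (len v - 1); split; [lia|].
      apply (holds_one_var X 1 0 0) in H; trivial.
      replace 1 with (1 * len u + 0 * occ u 0) at 1 by lia.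
      now replace (1 + (len v - 1)) with (1 * len v + 0 * occ v 0) by lia. }
  pose proof (len_pos u); pose proof (len_pos v); rewrite holds_Z in N.
  destruct (Nat.eq_dec (len u) 1) as [E|E].
  - apply (W u v); trivial; intros C; apply N; now left.
  - destruct (Nat.eq_dec (len v) 1) as [E'|E'].
    + apply (W v u); [now apply holds_sym|trivial|]; intros C; apply N; left; auto.
    + exfalso; apply N; right; lia.
Qed.

Lemma not_ZM_intro X n : 1 <= n -> pow_id X 1 (1 + n) -> ~ leC (Z 2) X.
Proof.
  intros Hn H C; rewrite leC_th in C; apply C, holds_Z in H.
  destruct H as [H|[H _]].
  - specialize (H 0); rewrite !occ_xp in H by lia; simpl in H; lia.
  - rewrite len_xp in H; lia.
Qed.

(** The power x^(mn) is idempotent, and an identity with a variable on one side only makes any two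
    such idempotents absorb each other. *)
Lemma idempotents_equal X m n : 1 <= m -> 1 <= n -> pow_id X m (m + n) -> ~ leC SL X ->
  holds X (tpow (SVar 0) (m * n)) (tpow (SVar 1) (m * n)).
Proof.
  intros Hm Hn HX HS; pose proof (leC_V X m n Hm Hn HX) as HV; rewrite leC_th in HV.
  assert (Hmn : 1 <= m * n) by nia.
  destruct (not_SL X HS) as (u & v & y & H & Hu & Hv).
  (* After this substitution the mn-th power of [u] becomes e e' and that of [v] becomes e. *)
  set (f := fun z => if z =? y then SMul (SVar 0) (SVar 1) else SVar 0).
  assert (O : forall t x, occ (subst f t) x = (if 0 =? x then len t else if 1 =? x then occ t y else 0)).
  { intros t x; induction t as [k|t1 IH1 t2 IH2].
    - cbn [subst]; unfold f; destruct (k =? y) eqn:Ek; destruct x as [|[|x]]; simpl; rewrite ?Ek; reflexivity.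
    - cbn [subst occ len]; rewrite IH1, IH2; destruct (0 =? x), (1 =? x); lia. }
  assert (Pw : forall k s t, 1 <= k -> holds X s t -> holds X (tpow s k) (tpow t k)).
  { intros k s t Hk Hst; induction k as [|[|k] IH]; [lia|exact Hst|].
    change (holds X (SMul s (tpow s (S k))) (SMul t (tpow t (S k)))); apply holds_mul; auto; apply IH; lia. }
  apply (holds_subst X f) in H; apply (Pw (m * n) _ _ Hmn) in H.
  set (e := tpow (SVar 0) (m * n)) in *; set (e' := tpow (SVar 1) (m * n)) in *.
  pose proof (len_pos u) as Lu; pose proof (len_pos v) as Lv.
  assert (CC : forall p, 1 <= p -> cg m n (p * (m * n)) (m * n)).
  { intros p Hp; right; split; [nia|split; [nia|]].
    now rewrite Nat.mul_assoc, !Nat.Div0.mod_mul. }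
  assert (H1 : holds X (SMul e e') e).
  { apply holds_trans with (tpow (subst f u) (m * n)).
    { apply HV, holds_V; intros x; unfold e, e'; cbn [occ]; rewrite !occ_tpow, O by trivial.
      apply cg_sym; destruct x as [|[|x]]; simpl.
      - rewrite !Nat.mul_1_r, Nat.mul_0_r, Nat.add_0_r, Nat.mul_comm; now apply CC.
      - rewrite !Nat.mul_1_r, Nat.mul_0_r, Nat.add_0_l, Nat.mul_comm; now apply CC.
      - left; lia. }
    apply holds_trans with (tpow (subst f v) (m * n)); trivial.
    apply HV, holds_V; intros x; unfold e; rewrite !occ_tpow, O by trivial.
    destruct x as [|[|x]]; simpl.
    - rewrite Nat.mul_1_r, Nat.mul_comm; now apply CC.
    - left; lia.
    - left; lia. }
  (* Exchanging the variables 0 and 1 gives e' e = e' as well. *)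
  pose proof (holds_subst X (fun z => SVar (1 - z)) _ _ H1) as H2.
  cbn [subst] in H2; unfold e, e' in H2; rewrite !subst_tpow in H2; simpl in H2.
  fold e e' in H2.
  apply holds_trans with (SMul e e'); [now apply holds_sym|].
  apply holds_trans with (SMul e' e); trivial.
  apply holds_occ; intros; simpl; lia.
Qed.

(** * Groups, semilattices, aperiodic and nil varieties *)

(** The four notions use only the order, [Z 2], [SL] and [bot], so they are first-order once these
    are definable. Here [regular] amounts to an identity x = x^(1+n), that is, to unions of
    groups. *)
Definition regular (X : Com) : Prop := ~ leC (Z 2) X.
Definition group_var (X : Com) : Prop := regular X /\ ~ leC SL X.
Definition aperiodic (X : Com) : Prop := forall g, group_var g -> leC g X -> g = bot.
Definition nil_var (X : Com) : Prop := aperiodic X /\ ~ leC SL X.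

Lemma join_lub X Y W : leC X W -> leC Y W -> leC (com_join X Y) W.
Proof. rewrite !leC_th; intros H1 H2 u v H; apply holds_join; auto. Qed.

Lemma leC_bot X : leC X bot -> X = bot.
Proof. intros H; apply leC_antisym; trivial; apply bot_leC. Qed.

Lemma V0_inj m n : 1 <= m -> 1 <= n -> V 0 m = V 0 n -> m = n.
Proof.
  intros Hm Hn E; apply Nat.divide_antisym; [apply (leC_V0 n m Hn)|apply (leC_V0 m n Hm)];
    rewrite E; apply leC_refl.
Qed.

Lemma cg_succ_mul m n : 1 <= m -> cg m n m (m + n).
Proof. intros H; replace n with (1 * n) at 2 by lia; now apply cg_add_mul. Qed.

Lemma regular_intro X n : 1 <= n -> pow_id X 1 (1 + n) -> regular X.
Proof. apply not_ZM_intro. Qed.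

Lemma pow_id_V0 n : 1 <= n -> pow_id (V 0 n) 1 (1 + n).
Proof. intros Hn; apply pow_id_V; try lia. replace n with (1 * n) at 2 by lia. apply cg_add_mul; lia. Qed.

Lemma group_var_V0 n : 1 <= n -> group_var (V 0 n).
Proof.
  intros Hn; split; [now apply regular_intro with n, pow_id_V0|].
  apply (not_SL_intro _ (SMul (SVar 1) (xp n)) (SVar 1) 0).
  - apply holds_V; intros x; cbn [occ]; rewrite occ_xp by trivial; destruct x as [|[|x]]; simpl.
    + right; split; [lia|split; [lia|]]. rewrite Nat.Div0.mod_0_l; apply Nat.Div0.mod_same.
    + left; lia.
    + left; lia.
  - cbn [occ]; rewrite occ_xp by trivial; simpl; lia.
  - reflexivity.
Qed.

Lemma regular_V1 n : 1 <= n -> regular (V 1 n).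
Proof. intros Hn; apply regular_intro with n; trivial; apply pow_id_V; try lia; now apply cg_succ_mul. Qed.

Lemma SL_leC_V1 n : leC SL (V 1 n).
Proof. rewrite (V_join 1 n); apply leC_join_l. Qed.

Lemma regular_classify X : regular X -> exists n, 1 <= n /\ (X = V 0 n \/ X = V 1 n).
Proof.
  intros HR; destruct (not_ZM X HR) as (k & Hk & Ek).
  destruct (index_period X 1 (1 + k)) as (m & n & I); try lia; trivial.
  pose proof I as (Hm & Hn & C).
  assert (m = 1) as ->.
  { apply C in Ek; try lia. destruct Ek; lia. }
  assert (P : pow_id X 1 (1 + n)) by (apply C; try lia; apply cg_succ_mul; lia).
  pose proof (leC_V X 1 n Hm Hn P) as HV; pose proof (V0_leC X 1 n I) as H0.
  exists n; split; trivial; destruct (classic (leC SL X)) as [HS|HS].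
  - right; apply leC_antisym; trivial; rewrite V_join; now apply join_lub.
  - left; apply leC_antisym; trivial.
    pose proof (idempotents_equal X 1 n Hm Hn P HS) as D; rewrite Nat.mul_1_l in D.
    rewrite leC_th in HV.
    (* All n-th powers coincide, so each acts as an identity element. *)
    assert (W : forall u s, holds X u (SMul u (tpow s n))).
    { intros u s; apply holds_trans with (SMul u (tpow u n)).
      - apply HV, holds_V; intros x; cbn [occ]; rewrite occ_tpow by trivial.
        destruct (Nat.eq_dec (occ u x) 0) as [E|E]; [left; lia|].
        rewrite (Nat.mul_comm n); apply cg_add_mul; lia.
      - apply holds_mul; [apply holds_refl|].
        apply (holds_subst X (fun z => if z =? 0 then u else s)) in D.
        rewrite !subst_tpow in D; exact D. }
    apply leC_th; intros u v H; rewrite holds_V in H.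
    (* Multiplying both sides by (uv)^n makes their variables the same, and then [cg 1 n] asks only
       for congruence modulo [n]. *)
    apply holds_trans with (SMul u (tpow (SMul u v) n)); [apply W|].
    apply holds_trans with (SMul v (tpow (SMul u v) n)); [|apply holds_sym, W].
    apply HV, holds_V; intros x; cbn [occ]; rewrite occ_tpow by trivial; cbn [occ].
    specialize (H x).
    destruct (Nat.eq_dec (occ u x + occ v x) 0) as [E|E]; [left; lia|].
    destruct H as [->|(_ & _ & H)]; [now left|].
    right; split; [nia|split; [nia|]].
    rewrite Nat.Div0.add_mod, H, <- Nat.Div0.add_mod; reflexivity.
Qed.

Lemma SL_not_leC_V0 n : 1 <= n -> ~ leC SL (V 0 n).
Proof. intros H; apply (group_var_V0 n H). Qed.

Lemma group_var_iff X : group_var X <-> exists n, 1 <= n /\ X = V 0 n.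
Proof.
  split.
  - intros [HR HS]; destruct (regular_classify X HR) as (n & Hn & [E|E]); [eauto|].
    exfalso; apply HS; rewrite E; apply SL_leC_V1.
  - intros (n & Hn & ->); now apply group_var_V0.
Qed.

Lemma regular_mono X Y : leC X Y -> regular Y -> regular X.
Proof. intros H HY C; apply HY; now apply leC_trans with X. Qed.

Lemma group_var_mono X Y : leC X Y -> group_var Y -> group_var X.
Proof.
  intros H [HY HS]; split; [now apply regular_mono with Y|].
  intros C; apply HS; now apply leC_trans with X.
Qed.

Lemma pow_id_mono X Y a b : leC X Y -> pow_id Y a b -> pow_id X a b.
Proof. rewrite leC_th; intros H; apply H. Qed.

Lemma SL_ne_bot : SL <> bot.
Proof. intros E; apply (SL_not_leC_V0 1); [lia|]. fold bot; rewrite <- E; apply leC_refl. Qed.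

Lemma V0_leC_SL n : 1 <= n -> leC (V 0 n) SL -> n = 1.
Proof.
  intros Hn H. assert (P : pow_id (V 0 n) 1 2).
  { apply (pow_id_mono _ _ _ _ H), pow_id_V; try lia. right; rewrite !Nat.mod_1_r; lia. }
  apply pow_id_V in P; try lia. destruct P as [P|(_&_&P)]; [lia|].
  destruct (mod_eq_add n 1 2) as [q Hq]; [lia|trivial|].
  assert (Q : q * n = 1) by lia; apply Nat.eq_mul_1 in Q; tauto.
Qed.

Lemma SL_atom Y : leC Y SL -> Y = bot \/ Y = SL.
Proof.
  intros H; destruct (regular_classify Y) as (n & Hn & E).
  { apply regular_mono with SL; trivial; apply regular_V1; lia. }
  assert (n = 1) as ->; [|exact E].
  apply V0_leC_SL; trivial; apply leC_trans with Y; trivial.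
  destruct E as [->| ->]; [apply leC_refl|rewrite (V_join 1 n); apply leC_join_r].
Qed.

(** The last clause lets [s] be split off from every regular variety above it. This excludes the
    group varieties, and minimality then singles out [SL] among the [V 1 d]. *)
Definition SL_spec (s : Com) : Prop :=
  regular s /\ s <> bot /\ (forall y, leC y s -> y = bot \/ y = s) /\
  forall X, regular X -> leC s X -> exists Y, regular Y /\ ~ leC s Y /\ X = com_join Y s.

Lemma com_join_comm X Y : com_join X Y = com_join Y X.
Proof. apply holds_ext; intros u v; rewrite !holds_join; tauto. Qed.

Lemma SL_spec_iff s : SL_spec s <-> s = SL.
Proof.
  split.
  - intros (HR & Hb & At & HX).
    destruct (regular_classify s HR) as (d & Hd & [E|E]).
    (* If [V 0 (d * d)] is the join of [V 0 e] and [V 0 d], then d^2 divides e d, so d divides e. *)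
    + exfalso. destruct (HX (V 0 (d * d))) as (Y & HY & Hn & EX).
      { apply (group_var_V0 (d * d)); nia. }
      { rewrite E; apply leC_V0; [nia|]. exists d; reflexivity. }
      assert (GY : group_var Y).
      { apply (group_var_mono _ (V 0 (d * d))); [rewrite EX; apply leC_join_l|apply group_var_V0; nia]. }
      apply group_var_iff in GY; destruct GY as (e & He & ->).
      rewrite E in *.
      assert (D : leC (com_join (V 0 e) (V 0 d)) (V 0 (e * d))).
      { apply join_lub; apply leC_V0; try nia; [exists d; lia|exists e; lia]. }
      rewrite <- EX in D; apply leC_V0 in D; [|nia].
      apply Hn, leC_V0; trivial. destruct D as [q D]; exists q; nia.
    + destruct (At SL) as [C|C]; [rewrite E; apply SL_leC_V1|now apply SL_ne_bot in C|auto].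
  - intros ->; split; [apply regular_V1; lia|]; split; [apply SL_ne_bot|]; split; [apply SL_atom|].
    intros X HR HS; destruct (regular_classify X HR) as (n & Hn & [E|E]).
    + exfalso; rewrite E in HS; now apply SL_not_leC_V0 in HS.
    + exists (V 0 n); split; [now apply group_var_V0|]; split; [now apply SL_not_leC_V0|].
      rewrite E, V_join; apply com_join_comm.
Qed.

Lemma aperiodic_intro X m : 1 <= m -> pow_id X m (m + 1) -> aperiodic X.
Proof.
  intros Hm H g Hg Hle; apply group_var_iff in Hg; destruct Hg as (n & Hn & ->).
  apply (pow_id_mono _ _ _ _ Hle), pow_id_V in H; try lia.
  destruct H as [H|(_&_&H)]; [lia|].
  destruct (mod_eq_add n m (m + 1)) as [q Hq]; [lia|trivial|].
  assert (Q : q * n = 1) by lia; apply Nat.eq_mul_1 in Q; destruct Q as [_ ->]; reflexivity.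
Qed.

Lemma SL_or_identity X : ~ leC SL X -> exists m n, has_index_period X m n.
Proof.
  intros H; destruct (not_SL X H) as (u & v & y & Huv & Hu & Hv).
  apply (index_period_th X u v y); trivial; lia.
Qed.

(** Since [V 0 2] is not below [X], some nontrivial identity holds, so [X] has an index and a period
    n; as [V 0 n] is below [X], n = 1. *)
Lemma aperiodic_index X : aperiodic X -> exists m, has_index_period X m 1.
Proof.
  intros H.
  assert (P : exists m n, has_index_period X m n).
  { destruct (classic (leC (V 0 2) X)) as [C|C].
    - exfalso; apply H in C; [|apply group_var_V0; lia]. apply V0_inj in C; lia.
    - apply not_leC in C; destruct C as (u & v & Huv & N).
      assert (D : exists y, occ u y <> occ v y).
      { apply NNPP; intros D; apply N, holds_occ; intros y; apply NNPP; intros E; apply D; eauto. }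
      destruct D as [y D]; now apply (index_period_th X u v y). }
  destruct P as (m & n & I); exists m; replace 1 with n; trivial.
  pose proof I as (Hm & Hn & _). apply V0_inj; try lia. fold bot.
  apply H; [now apply group_var_V0|now apply V0_leC with m].
Qed.

Lemma aperiodic_pow_id X : aperiodic X -> exists m, 1 <= m /\ pow_id X m (m + 1).
Proof.
  intros H; destruct (aperiodic_index X H) as (m & Hm & _ & C); exists m; split; trivial.
  apply C; try lia; now apply cg_succ_mul.
Qed.

(** * Words that are zero in a variety *)

Definition is_zero (X : Com) (u : sterm) : Prop := forall s, holds X u (SMul u s).

Definition nil_index (X : Com) (m : nat) : Prop := 1 <= m /\ forall t, is_zero X (tpow t m).

Lemma is_zero_th X u v : is_zero X u -> is_zero X v -> holds X u v.
Proof.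
  intros Hu Hv; apply holds_trans with (SMul u v); [apply Hu|].
  apply holds_trans with (SMul v u); [apply holds_occ; intros; simpl; lia|apply holds_sym, Hv].
Qed.

Lemma is_zero_conv X u v : holds X u v -> is_zero X v -> is_zero X u.
Proof.
  intros H Hv s; apply holds_trans with v; trivial; apply holds_trans with (SMul v s); auto.
  apply holds_mul; [now apply holds_sym|apply holds_refl].
Qed.

Lemma is_zero_mul X u v : is_zero X u -> is_zero X (SMul u v).
Proof.
  intros H s; apply holds_trans with u; [apply holds_sym, H|].
  apply holds_trans with (SMul u (SMul v s)); [apply H|apply holds_occ; intros; simpl; lia].
Qed.

Lemma is_zero_dvd X u v : (forall x, occ u x <= occ v x) -> is_zero X u -> is_zero X v.
Proof.
  intros H Hu; destruct (occ_divide u v H) as [E|[t E]].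
  - apply is_zero_conv with u; trivial; apply holds_occ; auto.
  - apply is_zero_conv with (SMul u t); [apply holds_occ; auto|now apply is_zero_mul].
Qed.

Lemma is_zero_occ X m w y : nil_index X m -> m <= occ w y -> is_zero X w.
Proof.
  intros [Hm H] Hy; apply is_zero_dvd with (tpow (SVar y) m); trivial.
  intros x; rewrite occ_tpow by trivial; simpl; destruct (Nat.eqb_spec y x); subst; lia.
Qed.

(** Instances of u = u s need not cover multiplication by every word, so [u] is first equated with
    the zero word x^m, whose instances are again m-th powers. *)
Lemma is_zero_subst X m f u : nil_index X m -> is_zero X u -> is_zero X (subst f u).
Proof.
  intros [Hm H] Hu; apply is_zero_conv with (tpow (f 0) m); trivial.
  change (f 0) with (subst f (SVar 0)); rewrite <- subst_tpow; apply holds_subst.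
  now apply is_zero_th.
Qed.

(** All m-th powers coincide, whence t^m = s^m = s^(m+1) = t^m s. *)
Lemma nil_var_nil_index X : nil_var X -> exists m, nil_index X m.
Proof.
  intros [HA HS]; destruct (aperiodic_pow_id X HA) as (m & Hm & P); exists m; split; trivial; intros t s.
  pose proof (idempotents_equal X m 1 Hm (le_n 1) P HS) as D; rewrite Nat.mul_1_r in D.
  assert (E : holds X (tpow t m) (tpow s m)).
  { apply (holds_subst X (fun z => if z =? 0 then t else s)) in D.
    rewrite !subst_tpow in D; exact D. }
  apply holds_trans with (tpow s m); trivial.
  apply holds_trans with (tpow s (m + 1)).
  { apply (holds_subst X (fun _ => s)) in P; unfold xp in P; rewrite !subst_tpow in P; exact P. }
  apply holds_trans with (SMul (tpow s m) s).
  { apply holds_occ; intros x; cbn [occ]; rewrite !occ_tpow by lia; lia. }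
  apply holds_mul; [now apply holds_sym|apply holds_refl].
Qed.

Lemma nil_index_pow_id X m : nil_index X m -> pow_id X m (m + 1).
Proof.
  intros [Hm H]; apply holds_trans with (SMul (xp m) (SVar 0)); [apply H|].
  apply holds_occ; intros x; cbn [occ]; rewrite !occ_xp by lia; destruct x; simpl; lia.
Qed.

Lemma nil_index_nil_var X m : nil_index X m -> nil_var X.
Proof.
  intros HN; pose proof HN as [Hm H]; split; [apply aperiodic_intro with m; trivial; now apply nil_index_pow_id|].
  apply (not_SL_intro X (SMul (xp m) (SVar 1)) (xp m) 1).
  - apply holds_sym, H.
  - simpl; lia.
  - now rewrite occ_xp.
Qed.

Lemma nil_var_mono X Y : leC X Y -> nil_var Y -> nil_var X.
Proof.
  intros H HY; destruct (nil_var_nil_index Y HY) as (m & Hm & HN); apply nil_index_nil_var with m.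
  rewrite leC_th in H; split; trivial; intros t s; apply H, HN.
Qed.

(** If a variable is missing from one side, putting its m-th power for it fixes that side and makes
    the other zero. Otherwise the linear [u] properly divides [v]. *)
Lemma is_zero_linear X u v : nil_var X -> holds X u v -> linear u ->
  ~ (forall x, occ u x = occ v x) -> is_zero X u.
Proof.
  intros HN H L N; destruct (nil_var_nil_index X HN) as (m & Hm).
  assert (W : forall u v y, holds X u v -> 1 <= occ u y -> occ v y = 0 -> is_zero X v).
  { clear - Hm; intros u v y H Hu Hv.
    pose proof Hm as [Hm1 _].
    pose (f := fun z => if z =? y then tpow (SVar y) m else SVar z).
    apply (holds_subst X f) in H.
    apply is_zero_conv with (subst f u).
    - apply holds_sym, holds_trans with (subst f v); trivial; apply holds_occ.
      assert (E : subst f v = subst SVar v).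
      { apply subst_ext; intros x Hx; unfold f; destruct (Nat.eqb_spec x y); [subst; lia|trivial]. }
      rewrite E; intros x; f_equal; clear; induction v; simpl; congruence.
    - apply (is_zero_occ X m _ y); trivial.
      pose proof (occ_subst_ge f u y y) as G.
      assert (Ef : f y = tpow (SVar y) m) by (unfold f; now rewrite Nat.eqb_refl).
      rewrite Ef, occ_tpow in G by trivial; simpl in G; rewrite Nat.eqb_refl in G; nia. }
  destruct (classic (exists y, 1 <= occ u y /\ occ v y = 0)) as [(y & Hu & Hv)|C1].
  { apply is_zero_conv with v; trivial; now apply (W u v y). }
  destruct (classic (exists y, 1 <= occ v y /\ occ u y = 0)) as [(y & Hv & Hu)|C2].
  { apply (W v u y); trivial; now apply holds_sym. }
  assert (Le : forall x, occ u x <= occ v x).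
  { intros x; specialize (L x); apply Nat.nlt_ge; intros Hx; apply C1; exists x; lia. }
  destruct (occ_divide u v Le) as [E|[t E]]; [contradiction|].
  (* Iterating u = u t brings in arbitrarily high powers of [t], which are zero. *)
  assert (P : forall k, holds X u (SMul u (tpow t (S k)))).
  { assert (B : holds X u (SMul u t)) by (apply holds_trans with v; [|apply holds_occ]; trivial).
    intros k; induction k as [|k IH]; [exact B|].
    apply holds_trans with (SMul (SMul u t) (tpow t (S k))).
    - apply holds_trans with (SMul u (tpow t (S k))); trivial; apply holds_mul; [trivial|apply holds_refl].
    - apply holds_occ; intros x; cbn [occ]; rewrite !occ_tpow by lia; lia. }
  destruct Hm as [Hm1 Hm]; specialize (P (m - 1)); replace (S (m - 1)) with m in P by lia.
  apply is_zero_conv with (SMul u (tpow t m)); trivial.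
  apply is_zero_dvd with (tpow t m); [intros; simpl; lia|apply Hm].
Qed.

(** Any word at least as long as a linear word is one of its substitution instances. *)
Lemma is_zero_long X u w : nil_var X -> linear u -> is_zero X u -> len u <= len w -> is_zero X w.
Proof.
  intros HN L Hu H; destruct (linear_subst u w L H) as [f Hf].
  destruct (nil_var_nil_index X HN) as (m & Hm).
  apply is_zero_conv with (subst f u); [apply holds_occ; auto|now apply is_zero_subst with m].
Qed.

(** * Exponents of groups against lengths of nil words *)

(** The index of [X] exceeds [k], so x^a = x^b with a <= k forces a = b; collapsing to one variable,
    with [y] of weight one or two, gives both claims. *)
Lemma ap_identity X k u v : 1 <= k -> aperiodic X -> ~ leC X (V k 1) -> holds X u v -> len u <= k ->
  len u = len v /\ forall y, occ u y = 0 <-> occ v y = 0.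
Proof.
  intros Hk HA HX H Hu; destruct (aperiodic_index X HA) as (m & Hm & _ & C).
  assert (Hkm : k < m).
  { apply Nat.nle_gt; intros Hmk; apply HX, leC_V; trivial; apply C; try lia.
    right; rewrite !Nat.mod_1_r; lia. }
  assert (R : forall a b, 1 <= a -> 1 <= b -> a <= k -> pow_id X a b -> a = b).
  { intros a b Ha Hb Hak P; apply C in P; trivial; destruct P; lia. }
  pose proof (len_pos u); pose proof (len_pos v).
  assert (E : len u = len v).
  { apply R; trivial. pose proof (holds_one_var X 1 0 0 u v (le_n 1) H) as P.
    now rewrite !Nat.mul_1_l, !Nat.mul_0_l, !Nat.add_0_r in P. }
  split; trivial; intros y.
  pose proof (holds_one_var X 1 1 y u v (le_n 1) H) as P; rewrite !Nat.mul_1_l in P.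
  split; intros D; rewrite D in P.
  - rewrite Nat.add_0_r in P; apply R in P; lia.
  - rewrite Nat.add_0_r in P; apply holds_sym, R in P; lia.
Qed.

(** Both sides have the same variables and the same length, at most [k]. A variable other than [y]
    occurs in both, so the exponents of [y] lie between 1 and k - 1. *)
Lemma ap_gap X k u v y : 1 <= k -> aperiodic X -> ~ leC X (V k 1) -> holds X u v ->
  len u <= k \/ len v <= k -> occ u y < occ v y -> occ v y + 2 <= k + occ u y.
Proof.
  intros Hk HA HX H HL Hlt.
  assert (E : len u = len v /\ len v <= k /\ forall y, occ u y = 0 <-> occ v y = 0).
  { destruct HL as [HL|HL].
    - destruct (ap_identity X k u v) as [E F]; trivial; split; [lia|split; [lia|exact F]].
    - destruct (ap_identity X k v u) as [E F]; trivial; [now apply holds_sym|].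
      split; [lia|split; [lia|intros z; symmetry; apply F]]. }
  destruct E as (E & Ev & F).
  pose proof (occ_le_len v y).
  destruct (occ_other u y) as (z & Hz & Hoz); [lia|].
  pose proof (occ_add_le_len v y z (not_eq_sym Hz)).
  pose proof (F y); pose proof (F z). lia.
Qed.

(** The identity x^k = x^(k+n) separates them, since x^k is not zero in [Z (S k)]. *)
Lemma Z_not_leC_V k n : 1 <= k -> 1 <= n -> ~ leC (Z (S k)) (V k n).
Proof.
  intros Hk Hn C; rewrite leC_th in C.
  assert (P : pow_id (V k n) k (k + n)) by (apply pow_id_V; try lia; now apply cg_succ_mul).
  apply C, holds_Z in P; destruct P as [P|[P _]].
  - specialize (P 0); rewrite !occ_xp in P by lia; simpl in P; lia.
  - rewrite len_xp in P; lia.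
Qed.

(** Exponents in words of length at most [k] are below the modulus k + 1, so congruent ones are
    equal. *)
Lemma Z_leC_join X k : 1 <= k -> aperiodic X -> ~ leC X (V k 1) ->
  leC (Z (S k)) (com_join X (V 0 (S k))).
Proof.
  intros Hk HA HX; apply leC_th; intros u v H.
  apply holds_join in H; destruct H as [H G]; rewrite holds_V in G; apply holds_Z.
  destruct (le_gt_dec (len u) k) as [Hu|Hu], (le_gt_dec (len v) k) as [Hv|Hv].
  4: right; lia.
  2: { destruct (ap_identity X k u v) as [E _]; trivial; lia. }
  2: { destruct (ap_identity X k v u) as [E _]; trivial; [now apply holds_sym|lia]. }
  left; intros x; pose proof (occ_le_len u x); pose proof (occ_le_len v x).
  destruct (G x) as [E|(_&_&E)]; trivial.
  now rewrite !Nat.mod_small in E by lia.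
Qed.

(* The monogenic nil semigroup x^(k+1) = 0, with [a] standing for x^(a+1) and [k] for 0. *)
Definition trunc_csg (k : nat) : csg.
Proof.
  refine (CSg nat (fun a b => Nat.min k (a + b + 1)) _ _); intros; lia.
Defined.

(** Numbers above [k] also belong to the carrier and a lone variable may take them; only products
    are truncated, hence the form of the left side. *)
Lemma seval_trunc k a u v :
  seval (trunc_csg k) a (SMul u v) =
    Nat.min k (seval nat_csg (fun x => a x + 1) (SMul u v) - 1).
Proof.
  set (t := SMul u v).
  assert (P : forall t, 1 <= seval nat_csg (fun x => a x + 1) t).
  { intros s; induction s as [n|s1 IH1 s2 IH2]; simpl in *; lia. }
  assert (W : forall t, Nat.min k (seval (trunc_csg k) a t) =
                        Nat.min k (seval nat_csg (fun x => a x + 1) t - 1)).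
  { intros s; induction s as [n|s1 IH1 s2 IH2]; cbn [seval]; [simpl; lia|].
    pose proof (P s1); pose proof (P s2). simpl in *. lia. }
  rewrite <- W; unfold t; simpl; lia.
Qed.

Lemma seval_nat_tpow a t k : 1 <= k -> seval nat_csg a (tpow t k) = k * seval nat_csg a t.
Proof. intros H; unfold nat_csg; rewrite seval_tpow by trivial; apply mpow_nat. Qed.

Lemma gap_witness k d : 1 <= d -> d + 2 <= k ->
  exists X, aperiodic X /\ ~ leC X (V k 1) /\ ~ leC (Z (S k)) (com_join X (V 0 d)).
Proof.
  intros Hd Hk; exists (var_gen (trunc_csg k)).
  assert (PX : forall a b, 2 <= a -> 2 <= b ->
    (pow_id (var_gen (trunc_csg k)) a b <-> a = b \/ k + 1 <= a /\ k + 1 <= b)).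
  { intros a b Ha Hb; unfold pow_id; rewrite holds_var_gen.
    assert (S : forall c f, 2 <= c -> seval (trunc_csg k) f (xp c) = Nat.min k (c * (f 0 + 1) - 1)).
    { intros [|[|c]] f Hc; [lia|lia|]. unfold xp.
      change (tpow (SVar 0) (S (S c))) with (SMul (SVar 0) (tpow (SVar 0) (S c))) at 1.
      rewrite seval_trunc.
      change (SMul (SVar 0) (tpow (SVar 0) (S c))) with (tpow (SVar 0) (S (S c))).
      rewrite seval_nat_tpow by lia; reflexivity. }
    split.
    - intros H; specialize (H (fun _ => 0)); simpl in H; rewrite !S in H by trivial; lia.
    - intros H f; simpl; rewrite !S by trivial. destruct H as [->|H]; [trivial|nia]. }
  split; [|split].
  - apply aperiodic_intro with (k + 1); [lia|]. apply PX; lia.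
  - intros C; apply (pow_id_mono _ _ k (k + 1)) in C; [apply PX in C; lia|].
    apply pow_id_V; try lia; apply cg_succ_mul; lia.
  - intros C; rewrite leC_th in C.
    (* Two words of length [k] in which [d] letters are traded from one variable to the other, so
       every exponent changes by [d]. *)
    set (u := SMul (tpow (SVar 0) (d + 1)) (tpow (SVar 1) (k - d - 1))).
    set (v := SMul (SVar 0) (tpow (SVar 1) (k - 1))).
    assert (H : holds (Z (S k)) u v).
    { apply C, holds_join; split.
      - apply holds_var_gen; intros f; unfold fst, snd, u, v; rewrite !seval_trunc.
        cbn [seval]; rewrite !seval_nat_tpow by lia; cbn [seval].
        set (a := f 0); set (b := f 1).
        change (Nat.min k ((d + 1) * (a + 1) + (k - d - 1) * (b + 1) - 1)
                = Nat.min k (a + 1 + (k - 1) * (b + 1) - 1)).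
        (* If both values are the generator, both words are its k-th power; otherwise both words
           reach the zero [k]. *)
        destruct (Nat.eq_dec a 0) as [->|Ha], (Nat.eq_dec b 0) as [->|Hb].
        + lia.
        + rewrite !Nat.min_l; nia.
        + rewrite !Nat.min_l; nia.
        + rewrite !Nat.min_l; nia.
      - apply holds_V; intros x; unfold u, v; cbn [occ]; rewrite !occ_tpow by lia; cbn [occ].
        destruct x as [|[|x]]; cbn [Nat.eqb]; [| |left; lia]; right; (split; [lia|split; [lia|]]).
        + replace ((d + 1) * 1 + (k - d - 1) * 0) with (1 + 1 * d) by lia.
          rewrite mod_add_eq; f_equal; lia.
        + replace (0 + (k - 1) * 1) with ((k - d - 1) + 1 * d) by lia.
          rewrite mod_add_eq; f_equal; lia. }
    apply holds_Z in H; destruct H as [H|[H _]].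
    + specialize (H 0); unfold u, v in H; cbn [occ] in H; rewrite !occ_tpow in H by lia;
        simpl in H; lia.
    + unfold u in H; cbn [len] in H; rewrite !len_tpow in H by lia; simpl in H; lia.
Qed.

(** An identity of the join that fails in [Z (S k)] has a side of length at most [k] and changes
    some exponent, by a positive multiple of [d] and by at most k - 2. *)
Lemma gap_bound k d X : 1 <= k -> aperiodic X -> ~ leC X (V k 1) ->
  ~ leC (Z (S k)) (com_join X (V 0 d)) -> d + 2 <= k.
Proof.
  intros Hk HA HX H; apply not_leC in H; destruct H as (u & v & H & N).
  apply holds_join in H; destruct H as [H G]; rewrite holds_V in G; rewrite holds_Z in N.
  assert (HL : len u <= k \/ len v <= k).
  { destruct (le_gt_dec (len u) k), (le_gt_dec (len v) k); auto; exfalso; apply N; right; lia. }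
  assert (D : exists y, occ u y <> occ v y).
  { apply NNPP; intros C; apply N; left; intros x; apply NNPP; intros E; apply C; eauto. }
  destruct D as [y D]; destruct (G y) as [E|(_&_&E)]; [contradiction|].
  destruct (Nat.lt_total (occ u y) (occ v y)) as [Hlt|[Hlt|Hlt]]; [|contradiction|].
  - pose proof (ap_gap X k u v y Hk HA HX H HL Hlt).
    destruct (mod_eq_add d (occ u y) (occ v y)) as [q Hq]; [lia|trivial|].
    destruct q; nia.
  - pose proof (ap_gap X k v u y Hk HA HX (holds_sym _ _ _ H)).
    destruct (mod_eq_add d (occ v y) (occ u y)) as [q Hq]; [lia|auto|].
    destruct q; [lia|]. assert (len v <= k \/ len u <= k) by tauto. specialize (H0 H1 Hlt). nia.
Qed.

(** * The chain below x^2 = 0 *)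

(** There being no empty word, [lin n] has n + 1 letters. *)
Fixpoint lin (n : nat) : sterm :=
  match n with 0 => SVar 0 | S n' => SMul (lin n') (SVar n) end.

Lemma occ_lin n x : occ (lin n) x = if x <=? n then 1 else 0.
Proof.
  induction n as [|n IH]; [destruct x; reflexivity|].
  cbn [lin occ]; rewrite IH.
  destruct (Nat.leb_spec x n), (Nat.eqb_spec (S n) x), (Nat.leb_spec x (S n)); lia.
Qed.

Lemma len_lin n : len (lin n) = S n.
Proof. induction n; simpl; lia. Qed.

Lemma linear_lin n : linear (lin n).
Proof. intros x; rewrite occ_lin; destruct (x <=? n); lia. Qed.

Lemma rees_not I u v : ~ rees_th I u v -> (~ forall x, occ u x = occ v x) /\ (~ I u \/ ~ I v).
Proof. unfold rees_th; intros H; split; [tauto|]. apply NNPP; tauto. Qed.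

Lemma nil_index_rees (I : sterm -> Prop) (HI : is_ideal I) m :
  1 <= m -> (forall t, I (tpow t m)) -> nil_index (com_of (rees_th I)) m.
Proof.
  intros Hm H; split; trivial; intros t s; apply holds_com_of; [now apply rees_theory|].
  right; split; trivial; now apply id_mul.
Qed.

Lemma nonlinear_sq t : nonlinear (tpow t 2).
Proof. destruct (occ_pos_ex t) as [x Hx]; exists x; rewrite occ_tpow; lia. Qed.

Lemma nil_var_Z k : 1 <= k -> nil_var (Z k).
Proof.
  intros Hk; apply nil_index_nil_var with k, nil_index_rees; trivial; [apply long_ideal|].
  intros t; rewrite len_tpow by trivial; pose proof (len_pos t); nia.
Qed.

Lemma nil_index_K2 : nil_index K2 2.
Proof. apply nil_index_rees; [apply nonlinear_ideal|lia|apply nonlinear_sq]. Qed.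

(** An identity of [X] failing in [L k] has a linear side of length at most [k]; that side is zero
    in [X], and so are all words of length [k] or more. *)
Lemma nil_var_leC_Z k X : nil_var X -> ~ leC (L k) X -> leC X (Z k).
Proof.
  intros HN H; apply not_leC in H; destruct H as (u & v & H & N); rewrite holds_L in N.
  apply rees_not in N; destruct N as [N HI].
  assert (W : exists w, linear w /\ len w <= k /\ is_zero X w).
  { destruct HI as [HI|HI].
    - exists u; assert (Lu : linear u) by (apply not_nonlinear; tauto).
      split; trivial; split; [lia|]. now apply (is_zero_linear X u v).
    - exists v; assert (Lv : linear v) by (apply not_nonlinear; tauto).
      split; trivial; split; [lia|]. apply (is_zero_linear X v u); auto; now apply holds_sym. }
  destruct W as (w & Lw & Hw & Zw); apply leC_th; intros s t Hst; apply holds_Z in Hst.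
  destruct Hst as [E|[Hs Ht]]; [now apply holds_occ|].
  apply is_zero_th; apply (is_zero_long X w); trivial; lia.
Qed.

(** The linear word of length [k] is zero in [Z k] but not in [L k]. *)
Lemma L_not_leC_Z k : 1 <= k -> ~ leC (L k) (Z k).
Proof.
  intros Hk C; rewrite leC_th in C.
  assert (H : holds (Z k) (lin (k - 1)) (SMul (lin (k - 1)) (SVar 0))).
  { apply holds_Z; right; cbn [len]; rewrite len_lin; lia. }
  apply C, holds_L in H; destruct H as [H|[[H|H] _]].
  - specialize (H 0); simpl in H; lia.
  - revert H; apply not_nonlinear, linear_lin.
  - rewrite len_lin in H; lia.
Qed.

Lemma L_mono j k : j <= k -> leC (L j) (L k).
Proof.
  intros H; apply leC_th; intros u v; rewrite !holds_L; intros [E|[H1 H2]]; [now left|].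
  right; split; [destruct H1|destruct H2]; auto; right; lia.
Qed.

Lemma L_leC_K2 k : leC (L k) K2.
Proof.
  apply leC_th; intros u v; rewrite holds_L, holds_K2; intros [E|[H1 H2]]; [now left|right; auto].
Qed.

Lemma L_leC_inv j k : leC (L k) (L j) -> k <= j.
Proof.
  intros C; apply Nat.nlt_ge; intros Hlt; rewrite leC_th in C.
  assert (H : holds (L j) (lin j) (SMul (lin j) (SVar 0))).
  { apply holds_L; right; split; right; cbn [len]; rewrite len_lin; lia. }
  apply C, holds_L in H; destruct H as [H|[[H|H] _]].
  - specialize (H 0); simpl in H; lia.
  - revert H; apply not_nonlinear, linear_lin.
  - rewrite len_lin in H; lia.
Qed.

Lemma K2_not_leC_L k : ~ leC K2 (L k).
Proof.
  intros C; assert (H : S k <= k); [|lia].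
  apply L_leC_inv; apply leC_trans with K2; trivial; apply L_leC_K2.
Qed.

(** Nonlinear words are already zero, so a proper subvariety is determined by the least length j of
    a linear zero word, and it is [L (j - 1)]. *)
Lemma sub_K2 X : leC X K2 -> X = K2 \/ exists k, X = L k.
Proof.
  intros H; destruct (classic (leC K2 X)) as [C|C]; [left; now apply leC_antisym|right].
  assert (HN : nil_var X) by (apply nil_var_mono with K2; trivial; apply nil_index_nil_var with 2, nil_index_K2).
  assert (ZN : forall w, nonlinear w -> is_zero X w).
  { intros w Hw s; rewrite leC_th in H; apply H, holds_K2; right; split; trivial.
    now apply id_mul; [apply nonlinear_ideal|]. }
  destruct (least_nat (fun j => exists w, linear w /\ len w = j /\ is_zero X w)) as [j [(w & Lw & Ew & Zw) Hj]].
  { apply not_leC in C; destruct C as (u & v & Huv & N); rewrite holds_K2 in N.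
    apply rees_not in N; destruct N as [N [HI|HI]].
    - exists (len u), u; apply not_nonlinear in HI; repeat split; trivial.
      now apply (is_zero_linear X u v).
    - exists (len v), v; apply not_nonlinear in HI; repeat split; trivial.
      apply (is_zero_linear X v u); auto; now apply holds_sym. }
  exists (j - 1); pose proof (len_pos w).
  apply leC_antisym; apply leC_th; intros u v Huv.
  - apply holds_L in Huv; destruct Huv as [E|[Hu Hv]]; [now apply holds_occ|].
    apply is_zero_th; [destruct Hu as [Hu|Hu]|destruct Hv as [Hv|Hv]]; auto;
      apply (is_zero_long X w); trivial; lia.
  - apply holds_L; apply NNPP; intros N; apply rees_not in N; destruct N as [N [HI|HI]].
    + assert (Lu : linear u) by (apply not_nonlinear; tauto).
      assert (j <= len u); [|apply HI; right; lia].
      apply Hj; exists u; repeat split; trivial; now apply (is_zero_linear X u v).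
    + assert (Lv : linear v) by (apply not_nonlinear; tauto).
      assert (j <= len v); [|apply HI; right; lia].
      apply Hj; exists v; repeat split; trivial; apply (is_zero_linear X v u); auto; now apply holds_sym.
Qed.

Definition ltC (X Y : Com) : Prop := leC X Y /\ X <> Y.

Definition chain (X : Com) : Prop :=
  forall Y W, leC Y X -> leC W X -> leC Y W \/ leC W Y.

Definition K2_spec (X : Com) : Prop :=
  chain X /\ X <> bot /\ forall Y, ltC Y X -> exists W, ltC Y W /\ ltC W X.

Lemma L0 : L 0 = bot.
Proof.
  apply leC_bot, leC_th; intros u v _; apply holds_L; right.
  pose proof (len_pos u); pose proof (len_pos v); split; right; lia.
Qed.

Lemma Z2_L1 : Z 2 = L 1.
Proof.
  apply holds_ext; intros u v; rewrite holds_Z, holds_L; unfold rees_th.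
  assert (E : forall t, nonlinear t -> 2 <= len t).
  { intros t [x Hx]; pose proof (occ_le_len t x); lia. }
  pose proof (E u); pose proof (E v); tauto.
Qed.

Lemma L_inj j k : L j = L k -> j = k.
Proof. intros E; apply Nat.le_antisymm; apply L_leC_inv; rewrite E; apply leC_refl. Qed.

Lemma K2_has_spec : K2_spec K2.
Proof.
  split; [|split].
  - intros Y W HY HW; destruct (sub_K2 Y HY) as [->|[i ->]]; [now right|].
    destruct (sub_K2 W HW) as [->|[j ->]]; [now left|].
    destruct (Nat.le_ge_cases i j); [left|right]; now apply L_mono.
  - intros E; apply (K2_not_leC_L 0); rewrite E, L0; apply leC_refl.
  - intros Y [HY NY]; destruct (sub_K2 Y HY) as [->|[i ->]]; [contradiction|].
    exists (L (S i)); split; split.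
    + apply L_mono; lia.
    + intros E; apply L_inj in E; lia.
    + apply L_leC_K2.
    + intros E; apply (K2_not_leC_L (S i)); rewrite E; apply leC_refl.
Qed.

(** The hypothesis puts a larger proper divisor of [n] above each proper divisor, so proper divisors
    would be unbounded. *)
Lemma no_coatom_V0 n : 2 <= n -> (forall Y, ltC Y (V 0 n) -> exists W, ltC Y W /\ ltC W (V 0 n)) -> False.
Proof.
  intros Hn H.
  assert (P : forall j, 1 <= j -> exists f, j <= f /\ ltC (V 0 f) (V 0 n)).
  { intros j Hj; induction j as [|j IH]; [lia|].
    destruct (Nat.eq_dec j 0) as [->|Hj0].
    - exists 1; split; trivial; split; [apply bot_leC|].
      intros E; apply V0_inj in E; lia.
    - destruct IH as (f & Hf & Hlt); [lia|].
      destruct (H _ Hlt) as (W & [H1 N1] & [H2 N2]).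
      assert (G : group_var W) by (apply group_var_mono with (V 0 n); trivial; apply group_var_V0; lia).
      apply group_var_iff in G; destruct G as (g & Hg & ->).
      apply leC_V0 in H1; trivial.
      assert (f <= g) by (apply Nat.divide_pos_le; [lia|trivial]).
      assert (f <> g) by congruence.
      exists g; split; [lia|now split]. }
  destruct (P n) as (f & Hf & [H1 H2]); [lia|].
  apply leC_V0 in H1; [|lia].
  assert (f <= n) by (apply Nat.divide_pos_le; [lia|trivial]).
  apply H2; f_equal; lia.
Qed.

Lemma L2_leC_Z3 : leC (L 2) (Z 3).
Proof.
  apply leC_th; intros u v; rewrite holds_L, holds_Z; intros [E|[H1 H2]]; [now left|right; auto].
Qed.

(** From x^2 = x^3 all higher powers equal x^2, and in a nil variety they are eventually zero. *)
Lemma leC_L2 X : nil_var X -> pow_id X 2 3 -> leC X K2.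
Proof.
  intros HN P; destruct (nil_var_nil_index X HN) as (m & Hm & Hz).
  assert (Z2 : is_zero X (xp 2)).
  { assert (Q : forall k, holds X (xp 2) (xp (2 + k))).
    { intros k; induction k as [|k IH]; [apply holds_refl|].
      apply holds_trans with (xp (2 + k)); trivial.
      replace (2 + S k) with (3 + k) by lia; apply pow_id_add; trivial; lia. }
    apply is_zero_conv with (xp (2 + m)); [apply Q|].
    apply is_zero_dvd with (xp m); [|apply Hz].
    intros x; rewrite !occ_xp by lia; destruct (0 =? x); lia. }
  assert (N2 : nil_index X 2).
  { split; [lia|]; intros t; pose proof (is_zero_subst X m (fun _ => t) _ (conj Hm Hz) Z2) as Q.
    unfold xp in Q; now rewrite subst_tpow in Q. }
  apply leC_th; intros u v H; apply holds_K2 in H.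
  destruct H as [E|[[x Hx] [y Hy]]]; [now apply holds_occ|].
  apply is_zero_th; eapply is_zero_occ; eassumption.
Qed.

(** Either x^2 = x^3 holds and squares are zero, or [ap_gap] with k = 2 leaves no room for an
    exponent to change in an identity with a side of length at most 2. *)
Lemma Z3_or_K2 X : nil_var X -> leC (Z 3) X \/ leC X K2.
Proof.
  intros HN; destruct (classic (leC X (V 2 1))) as [C|C].
  - right; apply leC_L2; trivial; apply (pow_id_mono _ _ _ _ C), pow_id_V; try lia.
    right; rewrite !Nat.mod_1_r; lia.
  - left; apply leC_th; intros u v H; apply holds_Z.
    destruct (le_gt_dec (len u) 2) as [Hu|Hu], (le_gt_dec (len v) 2) as [Hv|Hv]; [| | |right; lia].
    all: left; intros x; apply Nat.le_antisymm; apply Nat.nlt_ge; intros Hlt.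
    all: destruct HN as [HA _].
    all: first [ pose proof (ap_gap X 2 u v x ltac:(lia) HA C H ltac:(lia) Hlt); lia
               | pose proof (ap_gap X 2 v u x ltac:(lia) HA C (holds_sym _ _ _ H) ltac:(lia) Hlt); lia ].
Qed.

(** Above [Z 2] the chain condition excludes semilattices and groups, so [X] is nil, and every
    candidate but [K2] covers something. Otherwise [X] is [V 0 n] or [V 1 n], and these fail too. *)
Lemma K2_spec_unique X : K2_spec X -> X = K2.
Proof.
  intros (Ch & Nb & Nc).
  destruct (classic (leC (Z 2) X)) as [HZ|HR].
  - assert (HS : ~ leC SL X).
    { intros HS; destruct (Ch _ _ HZ HS) as [C|C].
      - apply (regular_V1 1); trivial.
      - revert C; apply (nil_var_Z 2); lia. }
    destruct (SL_or_identity X HS) as (m & n & I).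
    assert (n = 1) as ->.
    { pose proof I as (Hm & Hn & _).
      destruct (Ch _ _ HZ (V0_leC X m n I)) as [C|C]; [now apply (group_var_V0 n Hn) in C|].
      apply V0_inj; try lia; fold bot.
      apply (proj1 (nil_var_Z 2 ltac:(lia))); trivial; now apply group_var_V0. }
    assert (HN : nil_var X).
    { destruct I as (Hm & _ & I); split; trivial; apply aperiodic_intro with m; trivial.
      apply I; try lia; now apply cg_succ_mul. }
    destruct (Z3_or_K2 X HN) as [H3|HK].
    + exfalso.
      (* [L 3] and [Z 3] are incomparable, so the chain avoids [L 3], and this puts [X] below
         [Z 3]. *)
      assert (NL : ~ leC (L 3) X).
      { intros C; destruct (Ch _ _ H3 C) as [D|D]; [|revert D; apply L_not_leC_Z; lia].
        assert (D' : leC (Z 3) K2) by (apply leC_trans with (L 3); trivial; apply L_leC_K2).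
        apply (pow_id_mono _ _ 2 3), holds_Z in D'; [|apply nil_index_pow_id, nil_index_K2].
        destruct D' as [D'|[D' _]]; [|simpl in D'; lia].
        specialize (D' 0); simpl in D'; lia. }
      apply nil_var_leC_Z in NL; trivial.
      pose proof (leC_antisym _ _ NL H3) as ->.
      assert (NE : forall W, leC W K2 -> W <> Z 3).
      { intros W D' ->.
        apply (pow_id_mono _ _ 2 3), holds_Z in D'; [|apply nil_index_pow_id, nil_index_K2].
        destruct D' as [D'|[D' _]]; [|simpl in D'; lia].
        specialize (D' 0); simpl in D'; lia. }
      (* [Z 3] covers [L 2]: a variety strictly between them would lie below [K2] and be some [L k]
         with k < 3. *)
      destruct (Nc (L 2)) as (W & [H1 N1] & [H2 N2]).
      { split; [apply L2_leC_Z3|apply NE, L_leC_K2]. }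
      destruct (Z3_or_K2 W (nil_var_mono _ _ H2 HN)) as [D|D].
      * apply N2; now apply leC_antisym.
      * destruct (sub_K2 W D) as [->|[k ->]].
        -- apply (L_not_leC_Z 3); [lia|]. apply leC_trans with K2; trivial; apply L_leC_K2.
        -- assert (k < 3).
           { apply Nat.nle_gt; intros Hk; apply (L_not_leC_Z 3); [lia|].
             apply leC_trans with (L k); trivial; now apply L_mono. }
           apply N1, leC_antisym; trivial; apply L_mono; lia.
    + destruct (sub_K2 X HK) as [->|[k ->]]; [reflexivity|exfalso].
      destruct k as [|k]; [now apply Nb, L0|].
      (* [L (S k)] covers [L k]. *)
      destruct (Nc (L k)) as (W & [H1 N1] & [H2 N2]).
      { split; [apply L_mono; lia|]. intros E; apply L_inj in E; lia. }
      destruct (sub_K2 W) as [->|[j ->]].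
      * apply leC_trans with (L (S k)); trivial; apply L_leC_K2.
      * now apply K2_not_leC_L in H2.
      * apply L_leC_inv in H1, H2.
        assert (j <> k) by congruence. assert (j <> S k) by congruence. lia.
  - exfalso; destruct (regular_classify X HR) as (n & Hn & [->| ->]).
    + apply (no_coatom_V0 n); trivial.
      destruct (Nat.eq_dec n 1) as [->|]; [now contradict Nb|lia].
    (* Both [V 0 n] and [SL] lie below [V 1 n]; in a chain they are comparable. *)
    + assert (n = 1) as ->.
      { destruct (Ch (V 0 n) SL) as [C|C].
        - rewrite (V_join 1 n); apply leC_join_r.
        - apply SL_leC_V1.
        - now apply V0_leC_SL.
        - now apply SL_not_leC_V0 in C. }
      destruct (Nc bot) as (W & [H1 N1] & [H2 N2]).
      { split; [apply bot_leC|now auto]. }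
      destruct (SL_atom W H2) as [->| ->]; auto.
Qed.

(** * First-order definability *)

Notation env := (nat -> Com).
Notation sat := (lsat Com com_join com_meet).

(** Definability is a property of predicates on environments, so formulas are combined without being
    written out. *)
Definition dfn (P : env -> Prop) : Prop := exists Phi, forall rho, sat rho Phi <-> P rho.

(** Asking for a formula at each variable [i] replaces renaming of variables. *)
Definition dfn1 (U : Com -> Prop) : Prop := forall i, dfn (fun rho => U (rho i)).

Definition dfn_elt (c : Com) : Prop := dfn1 (fun x => x = c).

Definition dterm (f : env -> Com) : Prop :=
  exists t, forall rho, leval Com com_join com_meet rho t = f rho.

Lemma dterm_var i : dterm (fun rho => rho i).
Proof. exists (LVar i); reflexivity. Qed.

Lemma dterm_join f g : dterm f -> dterm g -> dterm (fun rho => com_join (f rho) (g rho)).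
Proof. intros [s Hs] [t Ht]; exists (LJoin s t); intros; simpl; now rewrite Hs, Ht. Qed.

Lemma dfn_ext P Q : (forall rho, P rho <-> Q rho) -> dfn P -> dfn Q.
Proof. intros H [Phi HP]; exists Phi; intros rho; now rewrite HP. Qed.

Lemma dfn_eq f g : dterm f -> dterm g -> dfn (fun rho => f rho = g rho).
Proof. intros [s Hs] [t Ht]; exists (LEq s t); intros; simpl; now rewrite Hs, Ht. Qed.

Lemma dfn_le f g : dterm f -> dterm g -> dfn (fun rho => leC (f rho) (g rho)).
Proof. intros; apply dfn_eq; trivial; now apply dterm_join. Qed.

Lemma dfn_not P : dfn P -> dfn (fun rho => ~ P rho).
Proof. intros [Phi H]; exists (LNot Phi); intros; simpl; now rewrite H. Qed.

Lemma dfn_and P Q : dfn P -> dfn Q -> dfn (fun rho => P rho /\ Q rho).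
Proof. intros [Phi H] [Psi H']; exists (LAnd Phi Psi); intros; simpl; now rewrite H, H'. Qed.

Lemma dfn_or P Q : dfn P -> dfn Q -> dfn (fun rho => P rho \/ Q rho).
Proof. intros [Phi H] [Psi H']; exists (LOr Phi Psi); intros; simpl; now rewrite H, H'. Qed.

Lemma dfn_imp P Q : dfn P -> dfn Q -> dfn (fun rho => P rho -> Q rho).
Proof. intros [Phi H] [Psi H']; exists (LImp Phi Psi); intros; simpl; now rewrite H, H'. Qed.

Lemma upd_same rho n a : upd Com rho n a n = a.
Proof. unfold upd; now rewrite Nat.eqb_refl. Qed.

Lemma upd_other rho n a m : m <> n -> upd Com rho n a m = rho m.
Proof. unfold upd; intros H; apply Nat.eqb_neq in H; now rewrite H. Qed.

(** Freshness in semantic form: [Q] ignores the value of variable [N], so [N] can be bound without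
    capture. *)
Definition fresh (N : nat) (Q : env -> Com -> Prop) : Prop :=
  forall rho a b, Q (upd Com rho N b) a <-> Q rho a.

Lemma dfn_all N Q : fresh N Q -> dfn (fun rho => Q rho (rho N)) -> dfn (fun rho => forall a, Q rho a).
Proof.
  intros HF [Phi H]; exists (LForall N Phi); intros rho; simpl.
  split; intros G a; specialize (G a); apply H in G || apply H;
    [rewrite upd_same in G; now apply HF in G|rewrite upd_same; now apply HF].
Qed.

Lemma dfn_ex N Q : fresh N Q -> dfn (fun rho => Q rho (rho N)) -> dfn (fun rho => exists a, Q rho a).
Proof.
  intros HF [Phi H]; exists (LExists N Phi); intros rho; simpl.
  split; intros [a G]; exists a; apply H in G || apply H;
    [rewrite upd_same in G; now apply HF in G|rewrite upd_same; now apply HF].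
Qed.

(** The constant becomes a bound variable constrained by the formula that defines [c]. *)
Lemma dfn_const c N Q : dfn_elt c -> fresh N Q -> dfn (fun rho => Q rho (rho N)) -> dfn (fun rho => Q rho c).
Proof.
  intros Hc HF H; apply dfn_ext with (fun rho => forall a, a = c -> Q rho a).
  - intros rho; split; [auto|intros G a ->; exact G].
  - apply (dfn_all N (fun rho a => a = c -> Q rho a)).
    + intros rho a b; specialize (HF rho a b); tauto.
    + apply dfn_imp; trivial; apply Hc.
Qed.

Lemma dfn_elt_unique c U : (forall x, U x <-> x = c) -> dfn1 U -> dfn_elt c.
Proof. intros H HU i; apply dfn_ext with (fun rho => U (rho i)); auto. Qed.

Ltac fresh_tac := intros ? ? ?; cbv beta; rewrite ?upd_other by lia; reflexivity.
Ltac dall N := apply (dfn_all N); [fresh_tac|cbv beta].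
Ltac dex N := apply (dfn_ex N); [fresh_tac|cbv beta].

Lemma dfn1_not U : dfn1 U -> dfn1 (fun x => ~ U x).
Proof. intros H i; now apply dfn_not. Qed.

Lemma dfn1_and U W : dfn1 U -> dfn1 W -> dfn1 (fun x => U x /\ W x).
Proof. intros H H' i; now apply dfn_and. Qed.

Lemma dfn1_le c : dfn_elt c -> dfn1 (fun x => leC x c).
Proof.
  intros H i; apply (dfn_const c (S i) (fun rho a => leC (rho i) a)); trivial; [fresh_tac|].
  apply dfn_le; apply dterm_var.
Qed.

Lemma dfn1_ge c : dfn_elt c -> dfn1 (fun x => leC c x).
Proof.
  intros H i; apply (dfn_const c (S i) (fun rho a => leC a (rho i))); trivial; [fresh_tac|].
  apply dfn_le; apply dterm_var.
Qed.

Lemma dfn_lt i j : dfn (fun rho => ltC (rho i) (rho j)).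
Proof. apply dfn_and; [apply dfn_le|apply dfn_not, dfn_eq]; apply dterm_var. Qed.

Lemma dfn1_chain : dfn1 chain.
Proof.
  intros i; unfold chain; dall (S i); dall (S (S i)).
  repeat apply dfn_imp; try apply dfn_or; apply dfn_le; apply dterm_var.
Qed.

Lemma bot_iff x : (forall y, leC x y) <-> x = bot.
Proof. split; [intros H; apply leC_bot, H|intros ->; apply bot_leC]. Qed.

Lemma dfn_bot : dfn_elt bot.
Proof.
  apply dfn_elt_unique with (1 := bot_iff).
  intros i; dall (S i); apply dfn_le; apply dterm_var.
Qed.

Lemma dfn_K2 : dfn_elt K2.
Proof.
  apply dfn_elt_unique with K2_spec.
  - intros x; split; [apply K2_spec_unique|intros ->; apply K2_has_spec].
  - apply dfn1_and; [apply dfn1_chain|]; apply dfn1_and; [apply dfn1_not, dfn_bot|].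
    intros i; dall (S i); apply dfn_imp; [apply dfn_lt|].
    dex (S (S i)); apply dfn_and; apply dfn_lt.
Qed.

Definition least_of (U : Com -> Prop) (x : Com) : Prop := U x /\ forall y, U y -> leC x y.
Definition greatest_of (U : Com -> Prop) (x : Com) : Prop := U x /\ forall y, U y -> leC y x.

Lemma dfn_least U c : dfn1 U -> least_of U c -> dfn_elt c.
Proof.
  intros HU Hc; apply dfn_elt_unique with (least_of U).
  - intros x; split; [|intros ->; trivial].
    intros [H1 H2]; destruct Hc; apply leC_antisym; auto.
  - apply dfn1_and; trivial; intros i; dall (S i).
    apply dfn_imp; [apply HU|apply dfn_le; apply dterm_var].
Qed.

Lemma dfn_greatest U c : dfn1 U -> greatest_of U c -> dfn_elt c.
Proof.
  intros HU Hc; apply dfn_elt_unique with (greatest_of U).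
  - intros x; split; [|intros ->; trivial].
    intros [H1 H2]; destruct Hc; apply leC_antisym; auto.
  - apply dfn1_and; trivial; intros i; dall (S i).
    apply dfn_imp; [apply HU|apply dfn_le; apply dterm_var].
Qed.

(** Each [L (S k)] is the least variety strictly above [L k] in the chain under [K2]. *)
Lemma dfn_L k : dfn_elt (L k).
Proof.
  induction k as [|k IH]; [rewrite L0; apply dfn_bot|].
  apply dfn_least with (fun x => (leC (L k) x /\ x <> L k) /\ leC x K2).
  - apply dfn1_and; [apply dfn1_and|]; [now apply dfn1_ge|now apply dfn1_not|].
    apply dfn1_le, dfn_K2.
  - split.
    + split; [split|apply L_leC_K2]; [apply L_mono; lia|].
      intros E; apply L_inj in E; lia.
    + intros y [[H1 N1] H2]; destruct (sub_K2 y H2) as [->|[j ->]]; [apply L_leC_K2|].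
      apply L_leC_inv in H1; apply L_mono; assert (j <> k) by congruence; lia.
Qed.

Lemma dfn1_regular : dfn1 regular.
Proof. apply dfn1_not, dfn1_ge; rewrite Z2_L1; apply dfn_L. Qed.

Lemma dfn_SL : dfn_elt SL.
Proof.
  apply dfn_elt_unique with (1 := SL_spec_iff).
  apply dfn1_and; [apply dfn1_regular|]; apply dfn1_and; [apply dfn1_not, dfn_bot|].
  apply dfn1_and; intros i.
  - dall (S i); apply dfn_imp; [apply dfn_le; apply dterm_var|].
    apply dfn_or; [apply dfn_bot|apply dfn_eq; apply dterm_var].
  - dall (S i); apply dfn_imp; [apply dfn1_regular|].
    apply dfn_imp; [apply dfn_le; apply dterm_var|].
    dex (S (S i)); apply dfn_and; [apply dfn1_regular|].
    apply dfn_and; [apply dfn_not, dfn_le; apply dterm_var|].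
    apply dfn_eq; [|apply dterm_join]; apply dterm_var.
Qed.

Lemma dfn1_group_var : dfn1 group_var.
Proof. apply dfn1_and; [apply dfn1_regular|apply dfn1_not, dfn1_ge, dfn_SL]. Qed.

Lemma dfn1_aperiodic : dfn1 aperiodic.
Proof.
  intros i; dall (S i); apply dfn_imp; [apply dfn1_group_var|].
  apply dfn_imp; [apply dfn_le; apply dterm_var|apply dfn_bot].
Qed.

Lemma dfn1_nil_var : dfn1 nil_var.
Proof. apply dfn1_and; [apply dfn1_aperiodic|apply dfn1_not, dfn1_ge, dfn_SL]. Qed.

Lemma dfn_Z k : 1 <= k -> dfn_elt (Z k).
Proof.
  intros Hk; apply dfn_greatest with (fun x => nil_var x /\ ~ leC (L k) x).
  - apply dfn1_and; [apply dfn1_nil_var|apply dfn1_not, dfn1_ge, dfn_L].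
  - split; [split; [now apply nil_var_Z|now apply L_not_leC_Z]|].
    intros y [H1 H2]; now apply nil_var_leC_Z.
Qed.

Lemma dfn_Z_join k i j : 1 <= k -> dfn (fun rho => leC (Z k) (com_join (rho i) (rho j))).
Proof.
  intros Hk; apply (dfn_const (Z k) (S (i + j)) (fun rho a => leC a (com_join (rho i) (rho j)))).
  - now apply dfn_Z.
  - fresh_tac.
  - apply dfn_le; [|apply dterm_join]; apply dterm_var.
Qed.

Lemma dfn_V1 k : dfn_elt (V k 1).
Proof.
  destruct k as [|k]; [apply dfn_bot|].
  (* Joining groups to [V (S k) 1] never reaches [Z (S (S k))], while any aperiodic variety not
     below [V (S k) 1] reaches it with exponent k + 2. *)
  apply dfn_greatest with
    (fun x => aperiodic x /\ forall g, group_var g -> ~ leC (Z (S (S k))) (com_join x g)).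
  - apply dfn1_and; [apply dfn1_aperiodic|]; intros i; dall (S i).
    apply dfn_imp; [apply dfn1_group_var|apply dfn_not, dfn_Z_join; lia].
  - split; [split|].
    + apply aperiodic_intro with (S k); [lia|apply pow_id_V; try lia; apply cg_succ_mul; lia].
    + intros g Hg; apply group_var_iff in Hg; destruct Hg as (n & Hn & ->).
      rewrite <- V_join; apply Z_not_leC_V; lia.
    + intros y [HA H]; apply NNPP; intros C.
      apply (H (V 0 (S (S k)))); [apply group_var_V0; lia|]. apply Z_leC_join; trivial; lia.
Qed.

(** A lattice condition that compares an exponent with a number: on [V 0 d] it amounts to d + 2 <=
    k. *)
Definition exceeds_gap (k : nat) (G : Com) : Prop :=
  exists X, aperiodic X /\ ~ leC X (V k 1) /\ ~ leC (Z (S k)) (com_join X G).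

Lemma dfn1_gap k : dfn1 (exceeds_gap k).
Proof.
  intros i; dex (S i); apply dfn_and; [apply dfn1_aperiodic|].
  apply dfn_and; [apply dfn_not, dfn1_le, dfn_V1|apply dfn_not, dfn_Z_join; lia].
Qed.

Lemma gap_iff k d : 1 <= k -> 1 <= d -> (exceeds_gap k (V 0 d) <-> d + 2 <= k).
Proof.
  intros Hk Hd; split; [|now apply gap_witness].
  intros (X & HA & HX & H); now apply (gap_bound k d X).
Qed.

(** Two consecutive thresholds pin the exponent d down: d + 2 <= n + 2, but not d + 2 <= n + 1. *)
Lemma dfn_V0 n : 1 <= n -> dfn_elt (V 0 n).
Proof.
  intros Hn; apply dfn_elt_unique with (fun x => group_var x /\ exceeds_gap (n + 2) x /\ ~ exceeds_gap (n + 1) x).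
  - intros x; split.
    + intros (HG & H1 & H2); apply group_var_iff in HG; destruct HG as (d & Hd & ->).
      rewrite gap_iff in H1, H2 by lia; f_equal; lia.
    + intros ->; split; [now apply group_var_V0|]. rewrite !gap_iff by lia; lia.
  - apply dfn1_and; [apply dfn1_group_var|]; apply dfn1_and; [apply dfn1_gap|apply dfn1_not, dfn1_gap].
Qed.

Lemma dfn_V m n : 1 <= n -> dfn_elt (V m n).
Proof.
  intros Hn i; rewrite V_join.
  apply (dfn_const (V m 1) (S i) (fun rho a => rho i = com_join a (V 0 n)));
    [apply dfn_V1|fresh_tac|].
  apply (dfn_const (V 0 n) (S (S i)) (fun rho a => rho i = com_join (rho (S i)) a));
    [now apply dfn_V0|fresh_tac|].
  apply dfn_eq; [|apply dterm_join]; apply dterm_var.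
Qed.

(** All variables but one can be set to the identity element, so an identity splits into conditions
    on single exponents. *)
Lemma holds_monoid (M : comMonoid) u v :
  holds (var_gen (csg_of_monoid M)) u v <->
  forall x (z : M), mpow M z (occ u x) = mpow M z (occ v x).
Proof.
  rewrite holds_var_gen; split.
  - intros H x z; specialize (H (fun y => if y =? x then z else mon_one M)); cbn [fst snd] in H.
    destruct (occ_bound u) as [N1 H1], (occ_bound v) as [N2 H2].
    rewrite !(seval_mprod M _ _ (S (max x (max N1 N2)))) in H
      by (intros; (apply H1 || apply H2); lia).
    assert (One : forall k, mpow M (mon_one M) k = mon_one M).
    { intros k; induction k as [|k IH]; [reflexivity|]; simpl; now rewrite mon_op1. }
    rewrite !(mprod_single M _ _ x) in H; try lia.
    + rewrite !Nat.eqb_refl in H; exact H.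
    + intros y Hy; apply Nat.eqb_neq in Hy; rewrite Hy; apply One.
    + intros y Hy; apply Nat.eqb_neq in Hy; rewrite Hy; apply One.
  - intros H a; apply seval_mpow_ext; auto.
Qed.

(** Pairs of exponents that give equal powers throughout [M] form a congruence on (N, +). If it is
    nontrivial, its index and period give [V m n]; otherwise [M] generates the top variety. *)
Lemma dfn_monoid (M : comMonoid) : dfn_elt (var_gen (csg_of_monoid M)).
Proof.
  set (E := fun a b => forall z : M, mpow M z a = mpow M z b).
  destruct (classic (exists a b, a <> b /\ E a b)) as [HE|HE].
  - destruct (congruence_classify E) as (m & n & Hn & C); trivial.
    + now intros a z.
    + intros a b H z; symmetry; apply H.
    + intros a b c H1 H2 z; now rewrite H1.
    + intros a b c H z; rewrite !mpow_add; f_equal; apply H.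
    + replace (var_gen (csg_of_monoid M)) with (V m n); [now apply dfn_V|].
      apply holds_ext; intros u v; rewrite holds_monoid, holds_V.
      split; intros H x; [exact (proj2 (C _ _) (H x))|apply C; intros z; apply H].
  - apply dfn_greatest with (fun _ => True); [intros i; exists LTrue; simpl; tauto|].
    split; trivial; intros y _; apply leC_th; intros u v H; rewrite holds_monoid in H.
    apply holds_occ; intros x; apply NNPP; intros N; apply HE; exists (occ u x), (occ v x); split; trivial.
    intros z; apply H.
Qed.

(** [dfn] does not restrict free variables, so the variables 1 to [B] are quantified away; truth
    depends on variable 0 alone, so the meaning is kept. *)
Fixpoint close (B : nat) (f : lform) : lform :=
  match B with 0 => f | S B' => LForall (S B') (close B' f) end.

Lemma occurs_close B f n : occurs_free n (close B f) -> occurs_free n f /\ (n = 0 \/ B < n).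
Proof.
  induction B as [|B IH]; simpl; [intros; split; [trivial|lia]|].
  intros [Hn H]; apply IH in H; split; [tauto|lia].
Qed.

Lemma sat_close c B Phi : (forall rho, sat rho Phi <-> rho 0 = c) ->
  forall rho, sat rho (close B Phi) <-> rho 0 = c.
Proof.
  intros H; induction B as [|B IH]; intros rho; simpl; [apply H|].
  split.
  - intros G; specialize (G c); apply IH in G; now rewrite upd_other in G by lia.
  - intros G a; apply IH; now rewrite upd_other by lia.
Qed.

Lemma occurs_t_bound t : exists B, forall n, occurs_t n t -> n <= B.
Proof.
  induction t as [m|s [B1 H1] t [B2 H2]|s [B1 H1] t [B2 H2]].
  - exists m; simpl; intros; lia.
  - exists (max B1 B2); intros n [H|H]; [apply H1 in H|apply H2 in H]; lia.
  - exists (max B1 B2); intros n [H|H]; [apply H1 in H|apply H2 in H]; lia.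
Qed.

Lemma occurs_bound f : exists B, forall n, occurs_free n f -> n <= B.
Proof.
  induction f as [s t| | |g [B H]|g [B1 H1] h [B2 H2]|g [B1 H1] h [B2 H2]|g [B1 H1] h [B2 H2]
                 |m g [B H]|m g [B H]].
  2, 3: exists 0; simpl; tauto.
  2: now exists B.
  5, 6: exists B; intros n [_ G]; auto.
  - destruct (occurs_t_bound s) as [B1 H1], (occurs_t_bound t) as [B2 H2].
    exists (max B1 B2); intros n [H|H]; [apply H1 in H|apply H2 in H]; lia.
  - exists (max B1 B2); intros n [H|H]; [apply H1 in H|apply H2 in H]; lia.
  - exists (max B1 B2); intros n [H|H]; [apply H1 in H|apply H2 in H]; lia.
  - exists (max B1 B2); intros n [H|H]; [apply H1 in H|apply H2 in H]; lia.
Qed.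

Theorem mainTheorem1 (M : comMonoid) :
  definable_elt Com com_join com_meet (var_gen (csg_of_monoid M)).
Proof.
  destruct (dfn_monoid M 0) as [Phi H]; destruct (occurs_bound Phi) as [B HB].
  exists (close B Phi); split.
  - intros n Hn; apply occurs_close in Hn; destruct Hn as [Hn [|Hn']]; trivial.
    apply HB in Hn; lia.
  - intros x; apply sat_close with (rho := fun _ => x), H.
Qed.
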